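(* Let $M=G/K$ be a homogeneous space, where $G$ is a Lie group with Lie algebra $\mathfrak{g}$ and $K$ is a compact Lie subgroup with Lie algebra $\mathfrak{k}$, and let $G$ be equipped with a Riemannian metric that is left invariant and bi-invariant with respect to $K$. Equip $AC([0,1],M)$ with the Riemannian metric and distance function transported from the quotient $(G\times L^2([0,1],\mathfrak{k}^\perp))/K$. Then this Riemannian metric on $AC([0,1],M)$ and the corresponding distance function are preserved by the action of $G$, $(g,\beta)\mapsto g\beta$ (pointwise left action on $M$), and by the action of the reparametrization group $\Gamma=\operatorname{Diff}^+([0,1])$, $(\beta,\gamma)\mapsto\beta\circ\gamma$.
   Context: $AC([0,1],N)$ denotes the set of absolutely continuous curves $[0,1]\to N$; $\Gamma=\operatorname{Diff}^+([0,1])$ is the group of smooth orientation-preserving diffeomorphisms of $[0,1]$ onto itself. ''Bi-invariant with respect to $K$'' means invariant under both left and right translation by elements of $K$. $L_g$ denotes left translation by $g$, on $G$ and on tangent vectors; $\pi:G\to M$ is the quotient map; $\mathfrak{k}^\perp$ is the orthogonal complement of $\mathfrak{k}$ in $\mathfrak{g}$. The map $Q: AC([0,1],G)\to G\times L^2([0,1],\mathfrak{g})$, $Q(\alpha)=(\alpha(0),q)$, with $q(t)=L_{\alpha(t)^{-1}}\alpha'(t)/\sqrt{\|\alpha'(t)\|}$ where $\alpha'(t)\ne0$ and $q(t)=0$ where $\alpha'(t)=0$, is a bijection. It restricts to a bijection from $AC^\perp([0,1],G)$ (absolutely continuous curves in $G$ orthogonal to each coset $gK$ they meet) onto $G\times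 L^2([0,1],\mathfrak{k}^\perp)$. The latter space carries the product of the metric on $G$ and the $L^2$ metric. $K$ acts on it freely and by isometries via $(\alpha_0,q)\ast y=(\alpha_0y,y^{-1}qy)$, where $y^{-1}qy$ is the pointwise adjoint action $\mathrm{Ad}(y^{-1})q(t)$. The quotient $(G\times L^2([0,1],\mathfrak{k}^\perp))/K$ inherits a Riemannian metric (making the projection a Riemannian submersion). The map sending the orbit of $(\alpha_0,q)$ to $\pi\circ Q^{-1}(\alpha_0,q)$ is a bijection from this quotient onto $AC([0,1],M)$, and the smooth structure and Riemannian metric on $AC([0,1],M)$ are defined by transport along it. The corresponding distance is $$d(\beta_1,\beta_2)=\inf_{y\in K}\left(d^2(\alpha_1(0),\alpha_2(0)y)+\|q_1-y^{-1}q_2y\|_{L^2}^2\right)^{1/2},$$ where $\alpha_i\in AC^\perp([0,1],G)$ is any lift of $\beta_i$ (i.e. $\pi\circ\alpha_i=\beta_i$), $Q(\alpha_i)=(\alpha_i(0),q_i)$, and $d$ on the right-hand side is the geodesic distance on $G$. *)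

(* Defs.v *)
From HB Require Import structures.
From mathcomp Require Import all_boot all_order all_algebra.
From mathcomp Require Import all_classical all_reals all_analysis.

Set Implicit Arguments.
Unset Strict Implicit.
Unset Printing Implicit Defensive.

Import Order.TTheory GRing.Theory Num.Theory.
Import numFieldNormedType.Exports.

Local Open Scope classical_set_scope.
Local Open Scope ring_scope.

HB.structure Definition TopGroup := { G of Topological G & Group G }.

Section Calculus.
Context {R : realType}.

(* C^k and C^oo on an open set U; the maps used below go from R, 'rV_n or
   'rV_n * 'rV_n to R or 'rV_m. *)
Fixpoint Ck (k : nat) (V W : normedModType R) (f : V -> W) (U : set V) : Prop :=
  if k is k'.+1 then
    (forall x, U x -> differentiable f x) /\
    (forall v, Ck k' (fun x => 'd f x v) U)
  else forall x, U x -> {for x, continuous f}.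

Definition smooth_on (V W : normedModType R) (f : V -> W) (U : set V) : Prop :=
  forall k, Ck k f U.

Definition abs_continuous (V : normedModType R) (f : R -> V) (a b : R) : Prop :=
  forall e : R, 0 < e -> exists2 d : R, 0 < d &
    forall (N : nat) (s t : 'I_N -> R),
      (forall i, a <= s i /\ s i <= t i /\ t i <= b) ->
      (forall i j, i != j -> t i <= s j \/ t j <= s i) ->
      \sum_(i < N) (t i - s i) < d ->
      \sum_(i < N) `|f (t i) - f (s i)| < e.

(* A smooth function on [0,1] is the restriction of a smooth function on R. *)
Definition smooth01 (f : R -> R) : Prop :=
  exists2 g : R -> R, @smooth_on R^o R^o g setT &
    forall t, 0 <= t <= 1 -> f t = g t.

(* Diff^+([0,1]); only the values of the functions on [0,1] matter. *)
Definition diff_plus (gamma : R -> R) : Prop :=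
  [/\ smooth01 gamma,
      forall t, 0 <= t <= 1 -> 0 <= gamma t <= 1,
      (forall s t, 0 <= s -> s < t -> t <= 1 -> gamma s < gamma t) &
      exists delta : R -> R,
        [/\ smooth01 delta,
            forall t, 0 <= t <= 1 -> 0 <= delta t <= 1,
            forall t, 0 <= t <= 1 -> gamma (delta t) = t &
            forall t, 0 <= t <= 1 -> delta (gamma t) = t]].

End Calculus.

(* A smooth n-manifold structure: every point x has a preferred chart
   [chart x], defined on [dom x], with inverse [ichart x] on the open set
   [img x].  The tangent space at x is 'rV_n, read in the preferred chart. *)
Record manifold (R : realType) (n : nat) (X : topologicalType) := Manifold {
  dom : X -> set X;
  img : X -> set 'rV[R]_n;
  chart : X -> X -> 'rV[R]_n;
  ichart : X -> 'rV[R]_n -> X;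
  mf_hausdorff : hausdorff_space X;
  mf_second_countable : @second_countable X;
  dom_open : forall x, open (dom x);
  img_open : forall x, open (img x);
  dom_center : forall x, dom x x;
  chart_img : forall x y, dom x y -> img x (chart x y);
  ichart_dom : forall x u, img x u -> dom x (ichart x u);
  chartK : forall x y, dom x y -> ichart x (chart x y) = y;
  ichartK : forall x u, img x u -> chart x (ichart x u) = u;
  chart_continuous : forall x y, dom x y -> {for y, continuous (chart x)};
  ichart_continuous : forall x u, img x u -> {for u, continuous (ichart x)};
  transition_smooth : forall x y,
    smooth_on (chart y \o ichart x) [set u | img x u /\ dom y (ichart x u)]
}.

Section Manifolds.
Context {R : realType}.

Definition smooth_into (V : normedModType R) (n : nat) (X : topologicalType)
    (A : manifold R n X) (f : V -> X) (U : set V) : Prop :=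
  (forall v, U v -> {for v, continuous f}) /\
  (forall y, smooth_on (chart A y \o f) [set v | U v /\ dom A y (f v)]).

Definition smooth_map (n m : nat) (X Y : topologicalType)
    (A : manifold R n X) (B : manifold R m Y) (f : X -> Y) : Prop :=
  forall x, smooth_into B (f \o ichart A x) (img A x).

(* The differential T_x X -> T_(f x) Y, in the preferred charts at x and f x. *)
Definition dmap (n m : nat) (X Y : topologicalType)
    (A : manifold R n X) (B : manifold R m Y) (f : X -> Y) (x : X)
    (u : 'rV[R]_n) : 'rV[R]_m :=
  'd (chart B (f x) \o f \o ichart A x) (chart A x x) u.

Section OneManifold.
Context (n : nat) (X : topologicalType) (A : manifold R n X).

Definition smooth_curve (c : R -> X) (I : set R) : Prop :=
  @smooth_into R^o n X A c I.

Definition velocity (c : R -> X) (t : R) : 'rV[R]_n :=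
  derive1 (fun s => chart A (c t) (c s)) t.

(* T_x S, for a submanifold S of X. *)
Definition tangent_to (S : set X) (x : X) (v : 'rV[R]_n) : Prop :=
  exists c : R -> X,
    [/\ smooth_curve c setT, forall s, S (c s), c 0 = x & velocity c 0 = v].

(* AC([0,1], X); only the values of the curve on [0,1] matter. *)
Definition AC_curve (c : R -> X) : Prop :=
  forall t, 0 <= t <= 1 -> exists2 e : R, 0 < e &
    (forall s, Num.max 0 (t - e) <= s <= Num.min 1 (t + e) ->
       dom A (c t) (c s)) /\
    abs_continuous (fun s => chart A (c t) (c s))
      (Num.max 0 (t - e)) (Num.min 1 (t + e)).

Definition riemannian_metric (g : X -> 'rV[R]_n -> 'rV[R]_n -> R) : Prop :=
  [/\ forall x u v, g x u v = g x v u,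
      forall x (a : R) u v w, g x (a *: u + v) w = a * g x u w + g x v w,
      forall x u, u != 0 -> 0 < g x u u &
      forall x v w, @smooth_on R 'rV[R]_n R^o
        (fun u => let T := 'd (chart A (ichart A x u) \o ichart A x) u in
                  g (ichart A x u) (T v) (T w)) (img A x)].

Variable g : X -> 'rV[R]_n -> 'rV[R]_n -> R.

Definition tnorm (x : X) (v : 'rV[R]_n) : R := Num.sqrt (g x v v).

Definition curve_length (c : R -> X) : \bar R :=
  (\int[lebesgue_measure]_(t in `[0%R, 1%R])
     (tnorm (c t) (velocity c t))%:E)%E.

(* Infimum of the lengths of the smooth (not necessarily regular) curves from
   x to y; +oo if x and y are in different components. *)
Definition geodesic_dist (x y : X) : \bar R :=
  ereal_inf (curve_length @`
    [set c : R -> X | [/\ smooth_curve c setT, c 0%R = x & c 1%R = y]]).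

End OneManifold.
End Manifolds.

Section LieGroups.
Context {R : realType} (n : nat) (G : TopGroup.type) (A : manifold R n G).

Definition lie_group : Prop :=
  (forall a b : G, @smooth_into R ('rV[R]_n * 'rV[R]_n)%type n G A
     (fun uv => ichart A a uv.1 * ichart A b uv.2)%g (img A a `*` img A b)) /\
  smooth_map A A (fun x : G => x^-1%g).

Definition subgroup (K : set G) : Prop :=
  [/\ K 1%g, forall x y, K x -> K y -> K (x * y)%g &
      forall x, K x -> K x^-1%g].

Definition dL (a x : G) : 'rV[R]_n -> 'rV[R]_n :=
  dmap A A (fun z : G => a * z)%g x.

Definition dR (a x : G) : 'rV[R]_n -> 'rV[R]_n :=
  dmap A A (fun z : G => z * a)%g x.

Definition Ad (y : G) : 'rV[R]_n -> 'rV[R]_n :=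
  dmap A A (fun x : G => y * x * y^-1)%g 1%g.

Definition lie_algebra (K : set G) : set 'rV[R]_n :=
  [set v | tangent_to A K 1%g v].

Variable g : G -> 'rV[R]_n -> 'rV[R]_n -> R.

Definition left_invariant (S : set G) : Prop :=
  forall a x u v, S a -> g (a * x)%g (dL a x u) (dL a x v) = g x u v.

Definition right_invariant (S : set G) : Prop :=
  forall a x u v, S a -> g (x * a)%g (dR a x u) (dR a x v) = g x u v.

End LieGroups.

(* M = G/K: the smooth structure of M is the one for which pi is a smooth
   submersion; [act] is the left action of G on M.  As K is a fiber of a
   submersion, it is an embedded Lie subgroup as soon as it is a subgroup. *)
Definition homogeneous_space (R : realType) (n m : nat) (G : TopGroup.type)
    (AG : manifold R n G) (K : set G) (M : topologicalType)
    (AM : manifold R m M) (pi : G -> M) (act : G -> M -> M) : Prop :=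
  smooth_map AG AM pi /\
  (forall x v, exists u, dmap AG AM pi x u = v) /\
  (forall b, exists x, pi x = b) /\
  (forall x y, pi x = pi y <-> K (x^-1 * y)%g) /\
  (forall a b, @smooth_into R ('rV[R]_n * 'rV[R]_m)%type m M AM
     (fun uv => act (ichart AG a uv.1) (ichart AM b uv.2))
     (img AG a `*` img AM b)) /\
  (forall a x, act a (pi x) = pi (a * x)%g).

Section CurveSpace.
Context {R : realType} (n m : nat) (G : TopGroup.type) (AG : manifold R n G).
Context (K : set G) (M : topologicalType) (AM : manifold R m M) (pi : G -> M).
Variable g : G -> 'rV[R]_n -> 'rV[R]_n -> R.

Let I01 : set R := `[0, 1].
Let mu := @lebesgue_measure R.

(* Elements of L^2([0,1], Lie(K)^perp) are represented by functions, equal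
   almost everywhere on [0,1] when they represent the same element. *)
Definition L2perp (q : R -> 'rV[R]_n) : Prop :=
  [/\ forall j, measurable_fun I01 (fun t => q t 0 j),
      (\int[mu]_(t in I01) (g 1%g (q t) (q t))%:E < +oo)%E &
      {ae mu, forall t, I01 t ->
         forall xi, lie_algebra AG K xi -> g 1%g xi (q t) = 0}].

Definition L2normsq (q : R -> 'rV[R]_n) : \bar R :=
  (\int[mu]_(t in I01) (g 1%g (q t) (q t))%:E)%E.

Definition L2inner (q1 q2 : R -> 'rV[R]_n) : R :=
  \int[mu]_(t in I01) g 1%g (q1 t) (q2 t).

(* P = G x L^2([0,1], Lie(K)^perp), with tangent spaces T_a G x L^2. *)
Let P := (G * (R -> 'rV[R]_n))%type.
Let TP := ('rV[R]_n * (R -> 'rV[R]_n))%type.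

Definition K_action (p : P) (y : G) : P :=
  ((p.1 * y)%g, fun t => Ad AG y^-1%g (p.2 t)).

Definition P_inner (p : P) (v w : TP) : R := g p.1 v.1 w.1 + L2inner v.2 w.2.

Definition L2_derivative (q : R -> R -> 'rV[R]_n) (s : R)
    (q' : R -> 'rV[R]_n) : Prop :=
  (fun h : R => L2normsq (fun t => h^-1 *: (q (s + h) t - q s t) - q' t))
    @ 0^' --> 0%E.

Definition P_velocity (c : R -> P) (v : TP) : Prop :=
  velocity AG (fst \o c) 0 = v.1 /\ L2_derivative (snd \o c) 0 v.2.

Definition P_smooth_curve (c : R -> P) (I : set R) : Prop :=
  smooth_curve AG (fst \o c) I /\
  exists D : nat -> R -> R -> 'rV[R]_n,
    (forall s, I s -> D 0 s = (c s).2) /\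
    (forall k s, I s -> L2perp (D k s) /\ L2_derivative (D k) s (D k.+1 s)).

(* The tangent space of the orbit p * K. *)
Definition vertical (p : P) (w : TP) : Prop :=
  L2perp w.2 /\
  exists y : R -> G,
    [/\ smooth_curve AG y setT, forall s, K (y s), y 0 = 1%g &
        P_velocity (fun s => K_action p (y s)) w].

Definition horizontal (p : P) (h : TP) : Prop :=
  L2perp h.2 /\ forall w, vertical p w -> P_inner p h w = 0.

Definition horizontal_part (p : P) (v h : TP) : Prop :=
  horizontal p h /\ vertical p (v.1 - h.1, fun t => v.2 t - h.2 t).

(* Q(alpha) = (alpha 0, srv alpha). *)
Definition srv (alpha : R -> G) (t : R) : 'rV[R]_n :=
  let v := velocity AG alpha t in
  if v == 0 then 0
  else (Num.sqrt (tnorm g (alpha t) v))^-1 *: dL AG (alpha t)^-1%g (alpha t) v.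

Definition AC_perp (alpha : R -> G) : Prop :=
  AC_curve AG alpha /\
  {ae mu, forall t, I01 t -> forall w,
     tangent_to AG [set z | K ((alpha t)^-1 * z)%g] (alpha t) w ->
     g (alpha t) (velocity AG alpha t) w = 0}.

(* beta = pi o Q^-1(p): the orbit of p corresponds to beta under the bijection
   P / K -> AC([0,1], M). *)
Definition projects (p : P) (beta : R -> M) : Prop :=
  exists alpha : R -> G,
    [/\ AC_perp alpha, alpha 0 = p.1, L2perp p.2,
        {ae mu, forall t, I01 t -> srv alpha t = p.2 t} &
        forall t, 0 <= t <= 1 -> beta t = pi (alpha t)].

(* Smooth curves s |-> B s in AC([0,1], M) = P / K: those which locally lift
   to smooth curves in P. *)
Definition smooth_AC_path (B : R -> R -> M) : Prop :=
  (forall s, AC_curve AM (B s)) /\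
  forall s0, exists2 e : R, 0 < e &
    exists2 c : R -> P, P_smooth_curve c (ball s0 e) &
      forall s, ball s0 e s -> projects (c s) (B s).

(* (p, v) represents the velocity at 0 of the curve B in P / K. *)
Definition lifted_velocity (B : R -> R -> M) (p : P) (v : TP) : Prop :=
  exists2 e : R, 0 < e &
    exists c : R -> P,
      [/\ P_smooth_curve c (ball 0 e), c 0 = p, P_velocity c v, L2perp v.2 &
          forall s, ball 0 e s -> projects (c s) (B s)].

(* <B1'(0), B2'(0)> = r in the quotient Riemannian metric on AC([0,1], M), for
   curves B1, B2 with B1 0 = B2 0: the metric for which the projection from P
   is a Riemannian submersion. *)
Definition AC_metric (B1 B2 : R -> R -> M) (r : R) : Prop :=
  exists (p : P) (v1 v2 h1 h2 : TP),
    [/\ lifted_velocity B1 p v1 /\ lifted_velocity B2 p v2,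
        horizontal_part p v1 h1, horizontal_part p v2 h2 &
        r = P_inner p h1 h2].

Definition orbit_dist (p1 p2 : P) : \bar R :=
  ereal_inf [set sqrte (geodesic_dist AG g p1.1 (K_action p2 y).1 ^+ 2 +
                        L2normsq (fun t => p1.2 t - (K_action p2 y).2 t)%R)%E
            | y in K].

(* The value of [orbit_dist] does not depend on the chosen lifts, so that the
   infimum over the lifts is the value at any of them. *)
Definition AC_dist (beta1 beta2 : R -> M) : \bar R :=
  ereal_inf [set orbit_dist p.1 p.2
            | p in [set p : P * P |
                     projects p.1 beta1 /\ projects p.2 beta2]].

(* F : AC([0,1], M) -> AC([0,1], M) preserves the smooth structure (smoothness
   being tested along smooth curves), the Riemannian metric (F^* < , > = < , >,
   the differential of F mapping the velocity of B to that of F o B) and the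
   distance. *)
Definition preserves_metric_and_dist (F : (R -> M) -> (R -> M)) : Prop :=
  [/\ forall beta, AC_curve AM beta -> AC_curve AM (F beta),
      forall B, smooth_AC_path B -> smooth_AC_path (F \o B),
      forall B1 B2 r, smooth_AC_path B1 -> smooth_AC_path B2 ->
        (forall t, 0 <= t <= 1 -> B1 0 t = B2 0 t) ->
        AC_metric (F \o B1) (F \o B2) r <-> AC_metric B1 B2 r &
      forall beta1 beta2, AC_curve AM beta1 -> AC_curve AM beta2 ->
        AC_dist (F beta1) (F beta2) = AC_dist beta1 beta2].

End CurveSpace.

(* Main.v *)
(** A symmetry of AC([0,1], M) is lifted to P = G x L^2([0,1], Lie(K)^perp) as a
    product (phi, tau).  For left translation by a, phi is x |-> a x and tau is
    the identity: left invariance of the metric gives q_(a alpha) = q_alpha.  For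
    a reparametrization p, phi is the identity and
    (tau q) t = sqrt (p' t) * q (p t), which preserves the L^2 inner product by
    the change of variables formula.  Both lifts are invertible isometries that
    commute with the action of K, hence they transport lifted curves, vertical
    and horizontal vectors and the orbit distance. *)
From HB Require Import structures.
Require Import Defs.
From mathcomp Require Import all_boot all_order all_algebra.
From mathcomp Require Import all_classical all_reals all_analysis.
From mathcomp Require Import measurable_realfun ring lra.

Set Implicit Arguments.
Unset Strict Implicit.
Unset Printing Implicit Defensive.

Import Order.TTheory GRing.Theory Num.Theory.
Import numFieldNormedType.Exports.

Local Open Scope classical_set_scope.
Local Open Scope ring_scope.

(** * Calculus of C^k maps *)

(** Curves and elements of L^2 are represented by functions on the whole line of which only the
    values on [0,1] count. A lift is therefore invertible only up to equality on [0,1], and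
    verticality, the metric and the distance must be shown insensitive to that. Moreover [derive1]
    is 0 where no derivative exists, so a velocity formula valid at every time needs an inverse map
    that carries derivability back. Inverses serve again because horizontality refers to every
    vertical vector at the image point, and the distance to every lift of the image curves; these
    are reached by applying the inverse lift. The maps tau commute with the action of K because the
    adjoint action is one fixed linear map for all times. The change of variables has to hold for
    functions that are merely measurable; it is proved for measures, by identifying the image of
    Lebesgue measure under the inverse of p with the measure of density p'. *)

Section Differentials.
Context {R : realType}.
Implicit Types V W : normedModType R.

Lemma diff_near_eq V W (f h : V -> W) x :
  (\near x, f x = h x) -> differentiable h x ->
  differentiable f x /\ 'd f x = 'd h x :> (V -> W).
Proof.
move=> fh dh.
have fxhx : f x = h x by exact: nbhs_singleton fh.
(* The first-order expansion determines the differential, so it suffices to transfer the little-o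
   estimate from [h] to [f] near [x]. *)
have E : f \o shift x = cst (f x) + 'd h x +o_ 0 id.
  apply/eqaddoP => e e0.
  have /eqaddoP/(_ e e0) H := diff_locally dh.
  have fh0 : \forall y \near 0, f (y + x) = h (y + x).
    by move: fh; rewrite (near_shift 0 x) subr0.
  by move: H fh0; apply: filterS2 => y; rewrite !fctE /= => + ->; rewrite fxhx.
have D : 'd f x = 'd h x :> (V -> W) by apply: diff_unique => //; exact: diff_continuous.
split=> //; apply/diff_locallyP; rewrite D; split=> //; exact: diff_continuous.
Qed.

Lemma diff_postlin V W (l : {linear V -> W}) (U : normedModType R) (f : U -> V) x :
  continuous l -> differentiable f x ->
  differentiable (l \o f) x /\ 'd (l \o f) x = l \o 'd f x :> (U -> W).
Proof.
move=> lc df; have dl := @linear_differentiable _ _ _ l (f x) lc.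
split; first exact: differentiable_comp.
by rewrite diff_comp// diff_lin.
Qed.

Lemma diff_scale V W (f : V -> R) (h : V -> W) x :
  differentiable f x -> differentiable h x ->
  differentiable (fun y => f y *: h y) x /\
  'd (fun y => f y *: h y) x = (fun v => f x *: 'd h x v + 'd f x v *: h x) :> (V -> W).
Proof.
move=> df dh.
(* Scaling is packaged as a continuous bilinear map, so that the product rule is its differential at
   the pair of values. *)
have sc_bilin : bilinear_for (GRing.Scale.Law.clone _ _ *:%R _)
    (GRing.Scale.Law.clone _ _ *:%R _) (@GRing.scale R W).
  split=> [u'|u] a x' y /=; first by rewrite scalerDl scalerA.
  by rewrite scalerDr !scalerA mulrC.
pose scM := bilinear_isBilinear.Build R R W W _ _ (@GRing.scale R W) sc_bilin.
pose scB : {bilinear R -> W -> W} := HB.pack (@GRing.scale R W) scM.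
have scc : continuous (fun p : R * W => scB p.1 p.2).
  by move=> p; exact: scale_continuous.
have dp := differentiable_pair df dh.
have ds := @differentiable_bilin _ _ _ _ scB (f x, h x) scc.
split; first exact: (differentiable_comp dp ds).
have := diff_comp dp ds; rewrite diff_pair//.
rewrite (diff_bilin (f x, h x) scc).
by move=> ->; apply/funext => v.
Qed.

End Differentials.

Section Ck_theory.
Context {R : realType}.
Implicit Types (V W : normedModType R) (k : nat).

Lemma Ck_sub k V W (f : V -> W) (U U' : set V) :
  U' `<=` U -> Ck k f U -> Ck k f U'.
Proof.
elim: k f => [|k IH] f UU'; first by move=> cf x /UU'; exact: cf.
by case=> df cf; split=> [x /UU'/df//|v]; exact: IH (cf v).
Qed.

Lemma CkW k V W (f : V -> W) (U : set V) : Ck k.+1 f U -> Ck k f U.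
Proof.
elim: k f => [|k IH] f [df cf].
  by move=> x Ux; apply: differentiable_continuous; exact: df.
by split=> // v; exact: IH (cf v).
Qed.

Lemma Ck_eq k V W (f h : V -> W) (U : set V) : open U ->
  {in U, f =1 h} -> Ck k h U -> Ck k f U.
Proof.
move=> oU; elim: k f h => [|k IH] f h fh.
  move=> ch x Ux; have nfh : \near x, f x = h x.
    by move: oU; rewrite openE => /(_ _ Ux); apply: filterS => y /mem_set/fh.
  rewrite /prop_for /continuous_at (nbhs_singleton nfh).
  apply: cvg_trans (ch x Ux); apply: near_eq_cvg.
  by move: nfh; apply: filterS => y ->.
move=> [dh ch].
have E x : U x -> differentiable f x /\ 'd f x = 'd h x :> (V -> W).
  move=> Ux; apply: diff_near_eq (dh _ Ux).
  by move: oU; rewrite openE => /(_ _ Ux); apply: filterS => y /mem_set/fh.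
split=> [x /E[]//|v]; apply: IH (ch v) => x /set_mem Ux.
by have [_ ->] := E x Ux.
Qed.

(** [Ck] is a condition at each point of the set, with full derivatives in the ambient space, so it
    can be checked point by point. *)
Lemma Ck_local k V W (f : V -> W) (U : set V) :
  (forall x, U x -> exists2 N : set V, N x & Ck k f N) -> Ck k f U.
Proof.
elim: k f => [|k IH] f loc.
  by move=> x /loc[N Nx]; apply.
split=> [x /loc[N Nx [dN _]]|v]; first exact: dN.
by apply: IH => x /loc[N Nx [_ cN]]; exists N => //; exact: cN.
Qed.

Lemma Ck_cst k V W (c : W) (U : set V) : Ck k (fun=> c) U.
Proof.
elim: k c => [|k IH] c; first by move=> x _; exact: cst_continuous.
split=> [x _|v]; first exact: differentiable_cst.
by rewrite (_ : (fun x => _) = (fun=> 0))//; apply/funext => x; rewrite diff_cst.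
Qed.

Lemma CkD k V W (f h : V -> W) (U : set V) : open U ->
  Ck k f U -> Ck k h U -> Ck k (fun x => f x + h x) U.
Proof.
move=> oU; elim: k f h => [|k IH] f h.
  by move=> cf ch x Ux; apply: continuousD; [exact: cf|exact: ch].
move=> [df cf] [dh ch]; split=> [x Ux|v].
  by apply: differentiableD; [exact: df|exact: dh].
apply: (@Ck_eq _ _ _ _ (fun x => 'd f x v + 'd h x v)) => //.
  by move=> x /set_mem Ux; rewrite (diffD (df x Ux) (dh x Ux)).
by apply: IH; [exact: cf|exact: ch].
Qed.

Lemma Ck_sum k V W n (f : 'I_n -> V -> W) (U : set V) : open U ->
  (forall i, Ck k (f i) U) -> Ck k (fun x => \sum_(i < n) f i x) U.
Proof.
move=> oU; elim: n f => [|n IH] f cf.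
  by under eq_fun do rewrite big_ord0; exact: Ck_cst.
under eq_fun do rewrite big_ord_recl.
by apply: CkD => //; exact: IH.
Qed.

Lemma CkZ k V W (f : V -> R) (h : V -> W) (U : set V) : open U ->
  Ck k f U -> Ck k h U -> Ck k (fun x => f x *: h x) U.
Proof.
move=> oU; elim: k f h => [|k IH] f h.
  by move=> cf ch x Ux; apply: continuousZ; [exact: cf|exact: ch].
(* The product rule pairs each factor with a derivative of the other, so the induction also uses [f]
   and [h] themselves at the lower order, by [CkW]. *)
move=> cf1 ch1; have := ch1; have := cf1; move=> [df cf] [dh ch].
split=> [x Ux|v]; first by have [] := diff_scale (df x Ux) (dh x Ux).
apply: (@Ck_eq _ _ _ _ (fun x => f x *: 'd h x v + 'd f x v *: h x)) => //.
  by move=> x /set_mem Ux; have [_ ->] := diff_scale (df x Ux) (dh x Ux).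
apply: CkD => //; first by apply: IH; [exact: CkW|exact: ch].
by apply: IH; [exact: cf|exact: CkW].
Qed.

Lemma Ck_postlin k V W (l : {linear V -> W}) (T : normedModType R) (f : T -> V)
    (U : set T) : open U -> continuous l -> Ck k f U -> Ck k (l \o f) U.
Proof.
move=> oU cl; elim: k f => [|k IH] f.
  by move=> cf x Ux; apply: continuous_comp; [exact: cf|exact: cl].
move=> [df cf]; split=> [x Ux|v]; first by have [] := diff_postlin cl (df x Ux).
apply: (@Ck_eq _ _ _ _ (l \o (fun x => 'd f x v))) => //; last exact: IH (cf v).
by move=> x /set_mem Ux; have [_ ->] := diff_postlin cl (df x Ux).
Qed.

Definition coord n (j : 'I_n) (u : 'rV[R]_n) : R := u 0 j.
Lemma coord_is_linear n (j : 'I_n) : linear (@coord n j).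
Proof. by move=> a u v; rewrite /coord !mxE. Qed.
HB.instance Definition _ n (j : 'I_n) :=
  GRing.isLinear.Build R 'rV[R]_n R _ (@coord n j) (@coord_is_linear n j).

Lemma continuous_coord n (j : 'I_n) : continuous (@coord n j).
Proof. by move=> u; exact: coord_continuous. Qed.

(* f o g where the inner map ranges in a finite-dimensional space, so that the
   chain rule can be expanded in coordinates. *)
Lemma Ck_comp k V W n (g : V -> 'rV[R]_n) (f : 'rV[R]_n -> W) U O :
  open U -> (forall x, U x -> O (g x)) ->
  Ck k f O -> Ck k g U -> Ck k (f \o g) U.
Proof.
move=> oU gUO; elim: k f => [|k IH] f.
  move=> cf cg x Ux; apply: continuous_comp; first exact: cg.
  exact/cf/gUO.
move=> [df cf] cg1; have [dg cg] := cg1; split=> [x Ux|v].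
  by apply: differentiable_comp; [exact: dg|exact/df/gUO].
apply: (@Ck_eq _ _ _ _ (fun x => \sum_(j < n)
   (coord j \o (fun x => 'd g x v)) x *:
   ((fun u => 'd f u (delta_mx 0 j)) \o g) x)) => //.
  move=> x /set_mem Ux; rewrite (diff_comp (dg x Ux) (df _ (gUO _ Ux))) /=.
  by rewrite {1}(row_sum_delta ('d g x v)) linear_sum; apply: eq_bigr => j _; rewrite linearZ.
apply: Ck_sum => // j; apply: CkZ => //.
  by apply: Ck_postlin; [|exact: continuous_coord|exact: cg].
by apply: IH; [exact: cf|exact: CkW].
Qed.

(** Complements [Ck_comp], whose inner map is valued in row vectors: here its target may be a
    product of two such spaces. The induction closes because the inner derivative is the constant
    [l]: deriving along [v] amounts to deriving [f] along [l v]. *)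
Lemma Ck_affine k V V' W (l : {linear V' -> V}) (b : V) (f : V -> W) (U : set V) :
  open U -> continuous l ->
  Ck k f U -> Ck k (fun x => f (b + l x)) [set x | U (b + l x)].
Proof.
move=> oU cl; have cbl : continuous (fun x => b + l x).
  by move=> x; apply: continuousD; [exact: cst_continuous|exact: cl].
have dbl x : differentiable (fun x => b + l x) x /\
    'd (fun x => b + l x) x = l :> (V' -> V).
  have dl := @linear_differentiable _ _ _ l x cl.
  have dc := @differentiable_cst _ V' V b x.
  split; first exact: (differentiableD dc dl).
  have lE : 'd (cst b) x \+ 'd l x = l :> (V' -> V).
    by rewrite (diff_cst b x) (diff_lin x cl); apply/funext => v; exact: add0r.
  exact: (etrans (diffD dc dl) lE).
elim: k f => [|k IH] f.
  move=> cf x Ux; apply: (@continuous_comp _ _ _ (fun x => b + l x) f).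
    exact: cbl.
  exact: cf.
move=> [df cf]; split=> [x Ux|v].
  by apply: (@differentiable_comp _ _ _ _ (fun x => b + l x) f);
    [have [] := dbl x|exact: df].
apply: (@Ck_eq _ _ _ _ (fun x => (fun y => 'd f y (l v)) (b + l x))).
- have /continuousP := cbl; exact.
- move=> x /set_mem /= Ux; have [d1 d2] := dbl x.
  by rewrite (diff_comp d1 (df _ Ux)) /= d2.
- exact: IH (cf (l v)).
Qed.

End Ck_theory.

(** * Local Lipschitz bounds for C^1 maps *)

Section Lipschitz.
Context {R : realType}.

Lemma normr_coord_le n (u : 'rV[R]_n) j : `|u 0 j| <= `|u|.
Proof.
rewrite [leRHS]/Num.norm /= mx_normrE.
by rewrite (le_bigmax _ (fun i => `|u i.1 i.2|) (0, j)).
Qed.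

Lemma normr_le_coord n (u : 'rV[R]_n) (M : R) :
  0 <= M -> (forall j, `|u 0 j| <= M) -> `|u| <= M.
Proof.
move=> M0 uM; rewrite /Num.norm /= mx_normrE; apply: bigmax_le => // -[i j] _ /=.
by rewrite ord1.
Qed.

Lemma Ck1_lipschitz n m (f : 'rV[R]_n -> 'rV[R]_m) (O : set 'rV[R]_n) u0 :
  open O -> O u0 -> Ck 1 f O -> exists2 e : R, 0 < e & exists2 L : R, 0 <= L &
  forall u v, ball u0 e u -> ball u0 e v -> `|f v - f u| <= L * `|v - u|.
Proof.
move=> oO Ou0 [df cf].
(* The margin 1 over the partial derivatives at [u0] makes the bound valid on a neighbourhood, by
   continuity. *)
pose M j := `|'d f u0 (delta_mx 0 j)| + 1.
have M_ge0 : 0 <= \sum_j M j by apply: sumr_ge0 => j _; rewrite addr_ge0.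
have bd : \forall u \near u0, O u /\ forall j, `|'d f u (delta_mx 0 j)| <= M j.
  apply: filterI; first by move: oO; rewrite openE; apply.
  suff H j : \forall u \near u0, `|'d f u (delta_mx 0 j)| <= M j.
    exact: (@filter_forall _ _ _ (nbhs u0) _ H).
  have := cf (delta_mx 0 j) u0 Ou0.
  move=> /cvgr_dist_lt/(_ 1 ltr01); apply: filterS => u ud.
  rewrite /M -lerBlDl; apply: le_trans (lerB_dist _ _) _.
  by rewrite distrC; exact: ltW ud.
have /nbhs_ballP[e /= e0 be] := bd.
exists e => //; exists (\sum_j M j) => // u v bu bv.
(* Balls are convex. Inside, [s = 0] is set apart because a strict inequality is multiplied by
   [s]. *)
have seg (s : R) : 0 <= s <= 1 -> ball u0 e (u + s *: (v - u)).
  move=> /andP[s0 s1]; rewrite -ball_normE /=.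
  have -> : u0 - (u + s *: (v - u)) = (1 - s) *: (u0 - u) + s *: (u0 - v).
    rewrite scalerBl scale1r !scalerBr opprD opprB.
    by apply/rowP => j; rewrite !mxE; ring.
  move: bu bv; rewrite -ball_normE /= => bu bv.
  rewrite (le_lt_trans (ler_normD _ _))// !normrZ.
  rewrite (ger0_norm s0) ger0_norm ?subr_ge0//.
  have [->|sn0] := eqVneq s 0; first by rewrite subr0 mul1r mul0r addr0.
  have sp : 0 < s by rewrite lt_neqAle eq_sym sn0.
  rewrite [ltRHS](_ : e = (1 - s) * e + s * e); last by ring.
  rewrite ler_ltD//.
    by rewrite ler_wpM2l ?subr_ge0// ltW.
  by rewrite ltr_pM2l.
(* The norm of a row is the maximum of its coordinates in absolute value, and each coordinate obeys
   the scalar mean value theorem along the segment from [u] to [v]. *)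
apply: normr_le_coord; first by rewrite mulr_ge0.
move=> i; rewrite !mxE.
pose p (s : R) := u + s *: (v - u).
have dp s : is_derive s (1 : R) p (v - u).
  rewrite -[X in is_derive _ _ _ X]add0r; apply: is_deriveD.
  have ds := @differentiableZl R R _ idfun (v - u) s.
  have := ds (@ex_diff _ _ _ _ _ _ _ (is_diff_id s)).
  move=> d1; apply: DeriveDef; first exact: diff_derivable.
  by rewrite deriveE// diffZl// diff_val /= scale1r.
pose phi s := coord i (f (p s)).
have dphi (s : R) : 0 <= s <= 1 -> is_derive s (1 : R) phi (coord i ('d f (p s) (v - u))).
  move=> s01; have [Op _] := be _ (seg _ s01).
  have dps : differentiable p s by apply/derivable1_diffP; exact: ex_derive.
  have dfp := differentiable_comp dps (df _ Op).
  have [d1 d2] := diff_postlin (continuous_coord (j := i)) dfp.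
  apply: DeriveDef; first exact: diff_derivable.
  rewrite deriveE// d2 /= diff_comp//; last exact: df.
  by rewrite /= -(deriveE _ dps) derive_val.
have [||c c01] := @MVT_segment R phi (fun s => coord i ('d f (p s) (v - u))) 0 1 ler01.
- by move=> s; rewrite in_itv /= => /andP[s0 s1]; apply: dphi; rewrite !ltW.
- apply: derivable_within_continuous => s; rewrite in_itv/= => s01.
  by have := dphi _ s01 => ?; exact: ex_derive.
rewrite /phi /p scale1r scale0r addr0 subr0 mulr1 (addrC u) subrK => phiE.
rewrite -[f v 0 i]/(coord i (f v)) -[f u 0 i]/(coord i (f u)) phiE.
rewrite in_itv /= in c01; have [_ bp] := be _ (seg _ c01).
rewrite -/(p c); set w := v - u.
rewrite [in 'd f _ w](row_sum_delta w) linear_sum /= linear_sum mulr_suml.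
rewrite (le_trans (ler_norm_sum _ _ _))//; apply: ler_sum => j _.
rewrite linearZ /= linearZ normrM mulrC ler_pM// ?normr_coord_le//.
by rewrite (le_trans (normr_coord_le _ _)).
Qed.

End Lipschitz.

(** * Absolutely continuous functions and smooth maps of manifolds *)

Section AbsContinuity.
Context {R : realType}.
Implicit Types (V W : normedModType R) (a b : R).

Lemma abs_continuous_sub V (f : R -> V) a b a' b' :
  a <= a' -> b' <= b -> abs_continuous f a b -> abs_continuous f a' b'.
Proof.
move=> aa bb fab e /fab[d d0 H]; exists d => // N s t st; apply: H => i.
have [s1 [s2 s3]] := st i; split; first exact: le_trans s1.
by split=> //; exact: le_trans bb.
Qed.

Lemma abs_continuous_le V W (f : R -> V) (h : R -> W) (L : R) a b : 0 <= L ->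
  (forall s t, a <= s <= b -> a <= t <= b -> `|h t - h s| <= L * `|f t - f s|) ->
  abs_continuous f a b -> abs_continuous h a b.
Proof.
move=> L0 hf fab e e0.
(* Dividing by [L + 1] avoids dividing by an [L] that may be 0. *)
have L1 : 0 < L + 1 by rewrite ltr_wpDl.
have [d d0 H] := fab (e / (L + 1)) (divr_gt0 e0 L1).
exists d => // N s t st dis lt; have := H N s t st dis lt.
rewrite ltr_pdivlMr// mulrC mulr_sumr; apply: le_lt_trans; apply: ler_sum => i _.
have [s1 [s2 s3]] := st i.
rewrite (le_trans (hf _ _ _ _))//.
- by rewrite s1 (le_trans s2 s3).
- by rewrite s3 (le_trans s1 s2).
- by rewrite ler_wpM2r// lerDl.
Qed.

(** Monotonicity of [p] keeps the image intervals from overlapping, and the Lipschitz bound keeps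
    their total length small. *)
Lemma abs_continuous_reparam V (f : R -> V) (p : R -> R) (L : R) a b a' b' :
  0 <= L -> (forall s, a <= s <= b -> a' <= p s <= b') ->
  (forall s t, a <= s -> s <= t -> t <= b -> p s <= p t <= p s + L * (t - s)) ->
  abs_continuous f a' b' -> abs_continuous (f \o p) a b.
Proof.
move=> L0 pab pL fab e e0; have [d d0 H] := fab e e0.
have L1 : 0 < L + 1 by rewrite ltr_wpDl.
exists (d / (L + 1)); first exact: divr_gt0.
move=> N s t st dis; rewrite ltr_pdivlMr// => lt.
have ps i : a <= s i <= b /\ a <= t i <= b.
  by have [s1 [s2 s3]] := st i; rewrite s1 s3 (le_trans s2 s3) (le_trans s1 s2).
apply: (H N (p \o s) (p \o t)) => [i|i j ij|/=].
- have [s1 [s2 s3]] := st i; have [/pab/andP[p1 _] /pab/andP[_ p2]] := ps i.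
  by have /andP[p3 _] := pL _ _ s1 s2 s3.
- have [/andP[i1 i2] /andP[i3 i4]] := ps i.
  have [/andP[j1 j2] /andP[j3 j4]] := ps j.
  have [h|h] := dis i j ij; [left|right].
    by have /andP[] := pL _ _ i3 h j2.
  by have /andP[] := pL _ _ j3 h i2.
- apply: le_lt_trans lt; rewrite mulrC mulr_sumr; apply: ler_sum => i _.
  have [s1 [s2 s3]] := st i; have /andP[_ p3] := pL _ _ s1 s2 s3.
  rewrite lerBlDl (le_trans p3)// lerD2l ler_wpM2r ?subr_ge0//.
  by rewrite lerDl.
Qed.

Lemma abs_continuous_unif V (f : R -> V) a b (e : R) : 0 < e ->
  abs_continuous f a b -> exists2 d : R, 0 < d &
  forall s t, a <= s <= b -> a <= t <= b -> `|t - s| < d -> `|f t - f s| < e.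
Proof.
move=> e0 /(_ e e0)[d d0 H]; exists d => //.
have K s t : a <= s -> s <= t -> t <= b -> t - s < d -> `|f t - f s| < e.
  move=> s1 s2 s3 std; have := H 1%N (fun=> s) (fun=> t).
  rewrite !big_ord1; apply => // i j; by rewrite !ord1 eqxx.
move=> s t /andP[s1 s2] /andP[t1 t2]; have [st|/ltW ts] := leP s t.
  by rewrite ger0_norm ?subr_ge0//; exact: K.
by rewrite distrC ger0_norm ?subr_ge0// distrC; exact: K.
Qed.

End AbsContinuity.

(** * Smooth maps of manifolds, read in charts *)

Section SmoothMaps.
Context {R : realType} (n m : nat) (X Y : topologicalType).
Context (A : manifold R n X) (B : manifold R m Y).

Lemma near_dom_at x : \forall y \near x, dom A x y.
Proof. by have := dom_open A x; rewrite openE; apply; exact: dom_center. Qed.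

Lemma chart_center_img x : img A x (chart A x x).
Proof. exact/chart_img/dom_center. Qed.

Lemma open_preimage_on (T Z : topologicalType) (U : set T) (D : set Z) (f : T -> Z) :
  open U -> open D -> (forall v, U v -> {for v, continuous f}) ->
  open [set v | U v /\ D (f v)].
Proof.
rewrite !openE => oU oD cf v [Uv Dfv]; rewrite /interior /=.
by apply: filterI; [exact: oU|apply: (cf v Uv); exact: oD].
Qed.

Lemma smooth_map_continuous (f : X -> Y) : smooth_map A B f -> continuous f.
Proof.
move=> sf x; have [cf _] := sf x.
have E : \forall y \near x, (f \o ichart A x) (chart A x y) = f y.
  by apply: filterS (near_dom_at x) => y /= dy; rewrite chartK.
rewrite /continuous_at -(nbhs_singleton E).
apply: cvg_trans; first exact: (near_eq_cvg E).
apply: (@continuous_comp _ _ _ (chart A x) (f \o ichart A x)).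
  exact/chart_continuous/dom_center.
exact/cf/chart_center_img.
Qed.

Definition loc_map (f : X -> Y) (x : X) := chart B (f x) \o f \o ichart A x.

Lemma smooth_map_loc (f : X -> Y) x : smooth_map A B f ->
  exists O : set 'rV[R]_n, [/\ open O, O (chart A x x),
    O `<=` [set u | img A x u /\ dom B (f x) (f (ichart A x u))] &
    smooth_on (loc_map f x) O].
Proof.
move=> /(_ x) [cf sf].
exists [set u | img A x u /\ dom B (f x) (f (ichart A x u))]; split => //.
- by apply: open_preimage_on; [exact: img_open|exact: dom_open|exact: cf].
- by split; [exact: chart_center_img|rewrite chartK; exact: dom_center].
- exact: sf.
Qed.

Lemma smooth_map_diff (f : X -> Y) x :
  smooth_map A B f -> differentiable (loc_map f x) (chart A x x).
Proof.
by move=> /(@smooth_map_loc f x)[N [_ Nx _ /(_ 1%N)[df _]]]; exact: df.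
Qed.

Lemma near_chart_loc (f : X -> Y) (T : topologicalType) (c : T -> X) t :
  {for t, continuous c} ->
  \forall s \near t, chart B (f (c t)) (f (c s)) =
                     (loc_map f (c t) \o (fun s => chart A (c t) (c s))) s.
Proof.
move=> ct; have : \forall s \near t, dom A (c t) (c s) by exact: ct _ (near_dom_at (c t)).
apply: filterS => s /= ds.
by rewrite /loc_map /= chartK.
Qed.

Lemma smooth_into_comp (V : normedModType R) (c : V -> X) (U : set V) (f : X -> Y) :
  open U -> smooth_map A B f -> smooth_into A c U -> smooth_into B (f \o c) U.
Proof.
move=> oU sf [cc sc].
have cfc v : U v -> {for v, continuous (f \o c)}.
  by move=> Uv; apply: continuous_comp; [exact: cc|exact: smooth_map_continuous].
split=> // y k; apply: Ck_local => v0 [Uv0 dv0].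
(* On [N] the map [c] is read in the preferred chart at [c v0], so the composite factors through row
   vectors and [Ck_comp] applies. *)
pose N := [set v | (U v /\ dom A (c v0) (c v)) /\ dom B y (f (c v))].
have [_ sfy] := sf (c v0).
have oN : open N.
  apply: (@open_preimage_on _ _ [set v | U v /\ dom A (c v0) (c v)] _ (f \o c)).
  - by apply: open_preimage_on => //; exact: dom_open.
  - exact: dom_open.
  - by move=> v [+ _]; exact: cfc.
exists N; first by split => //; split=> //; exact: dom_center.
apply: (@Ck_eq _ _ _ _ _ ((chart B y \o (f \o ichart A (c v0))) \o
                          (fun v => chart A (c v0) (c v)))) => //.
  by move=> v /set_mem[[_ dv] _] /=; rewrite chartK.
apply: (@Ck_comp _ _ _ _ _ (fun v => chart A (c v0) (c v)) _ N
   [set v | img A (c v0) v /\ dom B y ((f \o ichart A (c v0)) v)]) => //.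
- by move=> v [[_ dv] d2] /=; rewrite chartK//; split=> //; exact: chart_img.
- exact: sfy.
- by apply: Ck_sub (sc (c v0) k) => v [].
Qed.

End SmoothMaps.

(** * Velocities under reparametrizations and diffeomorphisms *)

Section Velocity.
Context {R : realType}.

(* The limit defining a derivative that does not exist is the junk value 0. *)
Lemma derive1_nonderivable n (f : R -> 'rV[R]_n) t :
  ~ derivable f t 1 -> derive1 f t = 0.
Proof.
move=> nf; rewrite /derive1 /lim /lim_in getPN.
  by apply/rowP => j; rewrite /point /= !mxE.
move=> l fl; apply: nf; apply: cvgP; apply: cvg_trans fl.
by under eq_fun do rewrite /= [_%:A]mulr1.
Qed.

Lemma derive1_chain n m (v : R -> 'rV[R]_n) (f : 'rV[R]_n -> 'rV[R]_m) t :
  derivable v t 1 -> differentiable f (v t) ->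
  derivable (f \o v) t 1 /\ derive1 (f \o v) t = 'd f (v t) (derive1 v t).
Proof.
move=> /derivable1_diffP dv df; have dfv := differentiable_comp dv df.
split; first exact/derivable1_diffP.
by rewrite !derive1E !deriveE// diff_comp.
Qed.

Lemma derive1_reparam n (v : R -> 'rV[R]_n) (p : R -> R) t :
  derivable p t 1 -> derivable v (p t) 1 ->
  derivable (v \o p) t 1 /\ derive1 (v \o p) t = derive1 p t *: derive1 v (p t).
Proof.
move=> /derivable1_diffP dp /derivable1_diffP dv.
have dvp := differentiable_comp dp dv.
split; first exact/derivable1_diffP.
have dpE : 'd p t 1 = derive1 p t by rewrite derive1E deriveE.
have dvE : 'd v (p t) 1 = derive1 v (p t) by rewrite derive1E deriveE.
have -> : derive1 (v \o p) t = 'd (v \o p) t 1 by rewrite derive1E deriveE.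
rewrite (diff_comp dp dv) [LHS]/= dpE -dvE -linearZ.
by congr ('d v (p t) _); rewrite [RHS]mulr1.
Qed.

(** The local inverse [q] settles the times where [c] has no derivative: were [c \o p] derivable at
    [t], so would be [c \o p \o q], which is [c] near [p t]. Both sides are then 0. *)
Lemma velocity_reparam n (X : topologicalType) (A : manifold R n X)
    (c : R -> X) (p q : R -> R) (t : R) :
  derivable p t 1 -> derivable q (p t) 1 -> q (p t) = t ->
  (\forall s \near p t, p (q s) = s) ->
  velocity A (c \o p) t = derive1 p t *: velocity A c (p t).
Proof.
move=> dp dq qpt pq; rewrite /velocity /=.
pose v s := chart A (c (p t)) (c s).
have [dv|ndv] := pselect (derivable v (p t) 1).
  by have [_] := derive1_reparam dp dv.
rewrite (derive1_nonderivable ndv) scaler0.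
apply: derive1_nonderivable => dvp; apply: ndv.
have {}dvp : derivable (v \o p) (q (p t)) 1 by rewrite qpt.
have [+ _] := @derive1_reparam _ (v \o p) q _ dq dvp.
by apply: near_eq_derivable; apply: filterS pq => s /= ->.
Qed.

Lemma dmap_comp n m k (X Y Z : topologicalType) (A : manifold R n X)
    (B : manifold R m Y) (C : manifold R k Z) (f : X -> Y) (h : Y -> Z) x u :
  smooth_map A B f -> smooth_map B C h ->
  dmap A C (h \o f) x u = dmap B C h (f x) (dmap A B f x u).
Proof.
move=> sf sh; rewrite /dmap.
have E : loc_map A B f x (chart A x x) = chart B (f x) (f x).
  by rewrite /loc_map /= chartK//; exact: dom_center.
have df := smooth_map_diff x sf; have dh := smooth_map_diff (f x) sh.
rewrite -E in dh *.
(* The local expressions compose only where [f] stays in the chart at [f x], which holds near the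
   centre. *)
have nE : \forall v \near chart A x x, (chart C (h (f x)) \o (h \o f) \o ichart A x) v =
    (loc_map B C h (f x) \o loc_map A B f x) v.
  have [N [oN Nx NO _]] := smooth_map_loc x sf.
  move: oN; rewrite openE => /(_ _ Nx); apply: filterS => v /NO[_ dv].
  by rewrite /loc_map /= chartK.
have [_ ->] := diff_near_eq nE (differentiable_comp df dh).
by rewrite diff_comp.
Qed.

Lemma dmap_id n (X : topologicalType) (A : manifold R n X) (f : X -> X) x u :
  f =1 id -> dmap A A f x u = u.
Proof.
move=> fid; rewrite /dmap.
have nE : \forall v \near chart A x x, (chart A (f x) \o f \o ichart A x) v = id v.
  have := @img_open _ _ _ A x; rewrite openE => /(_ _ (chart_center_img A x)). 
  by apply: filterS => v iv; rewrite /= !fid ichartK.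
have [_ ->] := diff_near_eq nE (@ex_diff _ _ _ _ _ _ _ (is_diff_id _)).
by rewrite diff_val.
Qed.

Lemma velocity_comp n m (X Y : topologicalType) (A : manifold R n X)
    (B : manifold R m Y) (f : X -> Y) (c : R -> X) t :
  smooth_map A B f -> {for t, continuous c} ->
  derivable (fun s => chart A (c t) (c s)) t 1 ->
  derivable (fun s => chart B (f (c t)) (f (c s))) t 1 /\
  velocity B (f \o c) t = dmap A B f (c t) (velocity A c t).
Proof.
move=> sf ct dc; have df := smooth_map_diff (c t) sf.
have [d1 d2] := derive1_chain dc df.
have E := near_chart_loc A B f ct.
have E' : \forall s \near t, (loc_map A B f (c t) \o
  (fun s => chart A (c t) (c s))) s = chart B (f (c t)) (f (c s)).
  by apply: filterS E => s ->.
split; first exact: (near_eq_derivable E' d1).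
by rewrite /velocity derive1E (near_eq_derive _ E) -derive1E d2.
Qed.

(** The inverse [h] carries derivability of [f \o c] back to [c]. Without a derivative both
    velocities are the default 0, and the differential maps 0 to 0. *)
Lemma velocity_diffeo n m (X Y : topologicalType) (A : manifold R n X)
    (B : manifold R m Y) (f : X -> Y) (h : Y -> X) (c : R -> X) t :
  smooth_map A B f -> smooth_map B A h -> cancel f h -> {for t, continuous c} ->
  velocity B (f \o c) t = dmap A B f (c t) (velocity A c t).
Proof.
move=> sf sh fK ct.
have [dc|ndc] := pselect (derivable (fun s => chart A (c t) (c s)) t 1).
  by have [] := velocity_comp sf ct dc.
rewrite [velocity A c t]derive1_nonderivable// /dmap linear0.
apply: derive1_nonderivable => dfc; apply: ndc.
have cfc : {for t, continuous (f \o c)}.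
  by apply: continuous_comp => //; exact: (smooth_map_continuous sf).
have [+ _] := @velocity_comp _ _ _ _ B A h (f \o c) t sh cfc dfc.
by rewrite /= fK; under eq_fun do rewrite fK.
Qed.

End Velocity.

(** * Absolutely continuous curves under smooth maps and reparametrizations *)

Section ACCurves.
Context {R : realType}.

Lemma AC_curve_comp n m (X Y : topologicalType) (A : manifold R n X)
    (B : manifold R m Y) (f : X -> Y) (c : R -> X) :
  smooth_map A B f -> AC_curve A c -> AC_curve B (f \o c).
Proof.
move=> sf ac t t01; have [e0 e00 [dc acc]] := ac t t01.
have [N [oN Nt NO sN]] := smooth_map_loc (c t) sf.
have [r r0 [L L0 lip]] := Ck1_lipschitz oN Nt (sN 1%N).
have : \forall u \near chart A (c t) (c t), N u.
  by move: oN; rewrite openE; apply.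
move=> /nbhs_ballP[r' /= r'0 bN].
(* Radius [r] gives the Lipschitz bound; [r'] keeps the coordinates in [N], where [f] lands in the
   chart at [f (c t)]. *)
have rr : 0 < Num.min r r' by rewrite lt_min r0.
have [d d0 unif] := abs_continuous_unif rr acc.
(* Half of [d], since the time window is closed while uniform continuity asks for a strict bound. *)
have dd : 0 < d / 2 by rewrite divr_gt0.
have [t0 t1] := andP t01.
have e1 : 0 < Num.min e0 (d / 2) by rewrite lt_min e00.
set e := Num.min e0 (d / 2) in e1 *.
have ee0 : e <= e0 by rewrite ge_min lexx.
have ed : e < d by rewrite gt_min ltr_pdivrMr// ltr_pMr// ltr1n orbT.
have lo : Num.max 0 (t - e0) <= Num.max 0 (t - e).
  by rewrite ge_max !le_max lexx/= lerB// orbT.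
have hi : Num.min 1 (t + e) <= Num.min 1 (t + e0).
  by rewrite le_min !ge_min lexx/= lerD// orbT.
have win s : Num.max 0 (t - e) <= s <= Num.min 1 (t + e) ->
    Num.max 0 (t - e0) <= s <= Num.min 1 (t + e0).
  by move=> /andP[s1 s2]; rewrite (le_trans lo)//= (le_trans s2).
have tw : Num.max 0 (t - e0) <= t <= Num.min 1 (t + e0).
  by rewrite ge_max t0 le_min t1 /= lerBlDr lerDl ltW.
have near s : Num.max 0 (t - e) <= s <= Num.min 1 (t + e) ->
    ball (chart A (c t) (c t)) (Num.min r r') (chart A (c t) (c s)).
  move=> sw; rewrite -ball_normE /= distrC; apply: unif => //; first exact: win.
  move: sw; rewrite ge_max le_min => /andP[/andP[_ s1] /andP[_ s2]].
  by rewrite (le_lt_trans _ ed)// ler_distl s1.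
have near1 s : Num.max 0 (t - e) <= s <= Num.min 1 (t + e) ->
    ball (chart A (c t) (c t)) r (chart A (c t) (c s)).
  by move=> /near; apply: le_ball; rewrite ge_min lexx.
exists e => //; split.
  move=> s sw /=; have /NO[_] : N (chart A (c t) (c s)).
    by apply: bN; apply: le_ball (near _ sw); rewrite ge_min lexx orbT.
  by rewrite chartK//; apply: dc; exact: win.
apply: (abs_continuous_le L0); last exact: abs_continuous_sub acc.
move=> s s' sw sw'; have := lip _ _ (near1 _ sw) (near1 _ sw').
by rewrite /loc_map /= !chartK//; apply: dc; exact: win.
Qed.

Lemma AC_curve_reparam n (X : topologicalType) (A : manifold R n X)
    (c : R -> X) (p : R -> R) (L : R) : 0 <= L ->
  (forall t, 0 <= t <= 1 -> 0 <= p t <= 1) ->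
  (forall s t, 0 <= s -> s <= t -> t <= 1 -> p s <= p t <= p s + L * (t - s)) ->
  AC_curve A c -> AC_curve A (c \o p).
Proof.
move=> L0 p01 pL ac t t01; have [e0 e00 [dc acc]] := ac _ (p01 _ t01).
have L1 : 0 < L + 1 by rewrite ltr_wpDl.
have [t0 t1] := andP t01.
(* Within [e] of [t], [p] moves by at most [L * e <= e0], so the window at [t] is sent into the
   given window at [p t]. *)
have e1 : 0 < e0 / (L + 1) by rewrite divr_gt0.
set e := e0 / (L + 1) in e1 *.
have Le : L * e <= e0.
  by rewrite /e mulrA ler_pdivrMr// mulrC ler_wpM2l ?(ltW e00)// lerDl.
have win s : Num.max 0 (t - e) <= s <= Num.min 1 (t + e) ->
    Num.max 0 (p t - e0) <= p s <= Num.min 1 (p t + e0).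
  rewrite ge_max le_min => /andP[/andP[s0 s1] /andP[s2 s3]].
  have /andP[ps0 ps1] : 0 <= p s <= 1 by rewrite p01// s0.
  rewrite ge_max le_min ps0 ps1 /=.
  have [ts|st] := leP t s.
    have /andP[p1 p2] := pL _ _ t0 ts s2.
    have : L * (s - t) <= L * e by rewrite ler_wpM2l// lerBlDl.
    by move=> h; apply/andP; split; lra.
  have /andP[p1 p2] := pL _ _ s0 (ltW st) t1.
  have : L * (t - s) <= L * e by rewrite ler_wpM2l//; lra.
  by move=> h; apply/andP; split; lra.
exists e => //; split; first by move=> s /win; exact: dc.
apply: (abs_continuous_reparam L0 win) acc => s s' s0 ss s1.
move: s0 s1; rewrite ge_max le_min => /andP[s0 _] /andP[s1 _].
exact: pL.
Qed.

End ACCurves.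

(** * Change of variables on [0,1] *)

Section Density.
Local Open Scope ereal_scope.
Context d (T : measurableType d) (R : realType).
Context (mu nu : {measure set T -> \bar R}) (D : set T) (rho : T -> R).
Import HBNNSimple.

(** Simple functions are handled level set by level set with the density formula; monotone
    convergence on both sides does the rest. *)
Lemma ge0_integral_density (f : T -> \bar R) :
  measurable D -> measurable_fun D rho -> (forall x, D x -> (0 <= rho x)%R) ->
  (forall A, measurable A -> A `<=` D -> nu A = \int[mu]_(x in A) (rho x)%:E) ->
  measurable_fun D f -> (forall x, D x -> 0 <= f x) ->
  \int[nu]_(x in D) f x = \int[mu]_(x in D) (f x * (rho x)%:E).
Proof.
move=> mD mrho rho0 nuE mf f0.
pose f_ := nnsfun_approx mD mf.
have cf x : D x -> (f_ n x)%:E @[n --> \oo] --> f x.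
  by move=> Dx; apply: cvg_nnsfun_approx.
have ndf x : {homo (fun n => (f_ n x)%:E) : m n / (m <= n)%N >-> m <= n}.
  by move=> i j ij; rewrite lee_fin; exact/lefP/nd_nnsfun_approx.
have merho : measurable_fun D (fun x => (rho x)%:E) by exact/measurable_EFinP.
have mfr n : measurable_fun D (fun x => (f_ n x)%:E * (rho x)%:E).
  by apply: emeasurable_funM => //; exact/measurable_EFinP/measurable_funTS.
transitivity (limn (fun n => \int[nu]_(x in D) (f_ n x)%:E)).
  rewrite -monotone_convergence//.
  - by apply: eq_integral => x /[!inE] Dx; apply/esym/cvg_lim => //; exact: cf.
  - by move=> n; exact/measurable_EFinP/measurable_funTS.
  - by move=> n x _; rewrite lee_fin.
transitivity (limn (fun n => \int[mu]_(x in D) ((f_ n x)%:E * (rho x)%:E))); last first.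
  rewrite -monotone_convergence//.
  - apply: eq_integral => x /[!inE] Dx; apply/cvg_lim => //.
    (* Where the density vanishes all the products are 0, even if [f x] is infinite. *)
    have [r0|r0] := eqVneq (rho x) 0%R.
      by rewrite r0; under eq_fun do rewrite mule0; rewrite mule0; exact: cvg_cst.
    by apply: cvgeZr => //; exact: cf.
  - by move=> n x Dx; rewrite mule_ge0// lee_fin// rho0.
  - by move=> x Dx i j ij; rewrite lee_wpmul2r// ?lee_fin ?rho0//; exact: ndf.
apply: congr_lim; apply/funext => n.
have mk r : measurable (f_ n @^-1` [set r]) by exact: measurable_sfunP.
transitivity (\sum_(k \in range (f_ n)) (k%:E * nu (f_ n @^-1` [set k] `&` D))).
  under eq_integral do rewrite fimfunE -fsumEFin//.
  rewrite ge0_integral_fsum//; last 2 first.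
  - by move=> y; exact/measurable_EFinP/measurable_funM.
  - by move=> y x _; rewrite nnfun_muleindic_ge0.
  by apply: eq_fsbigr => r _; rewrite integralZl_indic_nnsfun// integral_indic.
under [RHS]eq_integral => x _.
  rewrite fimfunE -fsumEFin// ge0_mule_fsuml; last first.
    by move=> y; rewrite nnfun_muleindic_ge0.
  over.
rewrite ge0_integral_fsum//; last 2 first.
- move=> y; apply: emeasurable_funM => //.
  by apply/measurable_EFinP; exact: measurable_funM.
- by move=> y x Dx; rewrite mule_ge0 ?nnfun_muleindic_ge0// lee_fin rho0.
apply: eq_fsbigr => r; rewrite inE /= => -[z _ zr].
have r0 : (0 <= r)%R by rewrite -zr.
rewrite nuE; [|exact: measurableI|exact: subIsetr].
transitivity (\int[mu]_(x in D)
    (r%:E * ((\1_(f_ n @^-1` [set r]) x)%:E * (rho x)%:E))); last first.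
  by apply: eq_integral => x _; rewrite muleA -EFinM.
rewrite ge0_integralZl//; last 2 first.
- apply: emeasurable_funM => //.
  by apply/measurable_EFinP/measurable_funTS; exact: measurable_indic.
- by move=> x Dx; rewrite mule_ge0// lee_fin ?rho0.
congr (_ * _); rewrite setIC integral_mkcondr; apply: eq_integral => x xD.
rewrite patchE indicE; case: ifPn => _; rewrite ?mul1e ?mul0e//.
Qed.

End Density.

(** * Orientation-preserving diffeomorphisms of [0,1] and their Jacobians *)

Section Reparametrization.
Context {R : realType}.
Implicit Types p q : R -> R.

(** The inverse is made explicit so that every fact about [p] transfers to [q] by [reparam_sym];
    monotonicity of [q] is derived there. *)
Record reparam p q : Prop := Reparam {
  reparam_smooth : smooth01 p;
  reparam_smooth_inv : smooth01 q;
  reparam01 : forall t, 0 <= t <= 1 -> 0 <= p t <= 1;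
  reparam_inv01 : forall t, 0 <= t <= 1 -> 0 <= q t <= 1;
  reparam_lt : forall s t, 0 <= s -> s < t -> t <= 1 -> p s < p t;
  reparamK : forall t, 0 <= t <= 1 -> q (p t) = t;
  reparamVK : forall t, 0 <= t <= 1 -> p (q t) = t }.

Lemma diff_plus_reparam p : diff_plus p -> exists q, reparam p q.
Proof. by case=> sp p01 p_lt [q [sq q01 qK pK]]; exists q; split. Qed.

Lemma reparam_sym p q : reparam p q -> reparam q p.
Proof.
case=> sp sq p01 q01 p_lt pK qK; split=> // s t s0 st t1.
have s01 : 0 <= s <= 1 by rewrite s0 (le_trans (ltW st)).
have t01 : 0 <= t <= 1 by rewrite t1 andbT (le_trans s0 (ltW st)).
rewrite ltNge le_eqVlt; apply/negP => /orP[/eqP E|ts].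
  by have := st; rewrite -(qK s)// -(qK t)// E ltxx.
have /andP[a _] := q01 _ t01; have /andP[_ b] := q01 _ s01.
by have := p_lt _ _ a ts b; rewrite !qK// ltNge (ltW st).
Qed.

Lemma reparam0 p q : reparam p q -> p 0 = 0.
Proof.
have I0 : 0 <= (0 : R) <= 1 by rewrite lexx ler01.
move=> rpq; have rqp := reparam_sym rpq.
have /andP[p0 _] := reparam01 rpq I0.
(* If [p 0 > 0], monotonicity of [q] would give [q 0 < q (p 0) = 0]. *)
apply/eqP; rewrite eq_le p0 andbT leNgt; apply/negP => p0_gt.
have := reparam_lt rqp (lexx 0) p0_gt.
have /andP[_ ->] := reparam01 rpq I0; rewrite (reparamK rpq)// => /(_ isT).
by have /andP[+ _] := reparam_inv01 rpq I0; rewrite leNgt => /negP.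
Qed.

Lemma reparam1 p q : reparam p q -> p 1 = 1.
Proof.
have I1 : 0 <= (1 : R) <= 1 by rewrite lexx ler01.
move=> rpq; have rqp := reparam_sym rpq.
have /andP[p0 p1] := reparam01 rpq I1.
apply/eqP; rewrite eq_le p1 /= leNgt; apply/negP => p1_lt.
have := reparam_lt rqp p0 p1_lt (lexx 1); rewrite (reparamK rpq)//.
by have /andP[_ +] := reparam_inv01 rpq I1; rewrite leNgt => /negP.
Qed.

Lemma reparam_oo p q (t : R) : reparam p q -> 0 < t < 1 -> 0 < p t < 1.
Proof.
move=> rpq /andP[t0 t1]; apply/andP; split.
  by rewrite -[ltLHS](reparam0 rpq) (reparam_lt rpq)// ltW.
by rewrite -[ltRHS](reparam1 rpq) (reparam_lt rpq)// ltW.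
Qed.

Lemma reparam_le p q s t : reparam p q -> 0 <= s -> s <= t -> t <= 1 -> p s <= p t.
Proof.
by move=> rpq s0; rewrite le_eqVlt => /predU1P[->//|st] t1; rewrite ltW ?(reparam_lt rpq).
Qed.

(** Since [p] is arbitrary outside [0,1], its regularity up to the endpoints is read off a C^1
    function on the whole line. *)
Lemma reparam_ext p q : reparam p q -> exists g : R -> R,
  [/\ forall t, derivable g t 1, continuous (derive1 g) &
      forall t, 0 <= t <= 1 -> p t = g t].
Proof.
move=> rpq; have [g sg pg] := reparam_smooth rpq.
have [dg cg] := sg 1%N.
have dg' t : derivable g t 1 by apply/derivable1_diffP; exact: dg.
exists g; split; [exact: dg'| |exact: pg] => t; have := cg 1 t I.
rewrite (_ : (fun x => _) = derive1 g)//; apply/funext => x.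
by rewrite derive1E deriveE//; exact: dg.
Qed.

Lemma near_oo (t : R) : 0 < t < 1 -> \forall s \near t, 0 <= s <= 1.
Proof.
move=> /andP[t0 t1]; near=> s; apply/andP; split.
  by apply: ltW; near: s; exact: lt_nbhsr.
by apply: ltW; near: s; exact: lt_nbhsl.
Unshelve. all: by end_near. Qed.

Lemma reparam_derivable p q (g : R -> R) t : reparam p q ->
  (forall t, 0 <= t <= 1 -> p t = g t) -> (forall t, derivable g t 1) ->
  0 < t < 1 -> derivable p t 1 /\ derive1 p t = derive1 g t.
Proof.
move=> rpq pg dg t01; have /filterS E := near_oo t01; split.
  by apply: near_eq_derivable (dg t); apply: E => s /pg.
by rewrite !derive1E; apply: near_eq_derive; apply: E => s /pg.
Qed.

Lemma reparam_derivable_oo p q (t : R) : reparam p q -> 0 < t < 1 -> derivable p t 1.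
Proof.
move=> rpq t01; have [g [dg _ pg]] := reparam_ext rpq.
by have [] := reparam_derivable rpq pg dg t01.
Qed.

(* The derivative of p; at the endpoints, where [derive1 p] would depend on the
   values of p outside of [0,1], the value 1 keeps [jacVM] true. *)
Definition jac p t : R := if 0 < t < 1 then derive1 p t else 1.

Lemma reparam_near p q (t : R) : reparam p q -> 0 < t < 1 ->
  \forall s \near t, q (p s) = s.
Proof. by move=> rpq /near_oo; apply: filterS => s /(reparamK rpq). Qed.

Lemma reparam_itv01 p q (t : R) : reparam p q -> 0 <= t <= 1 ->
  (0 < p t < 1) = (0 < t < 1).
Proof.
move=> rpq t01; apply/idP/idP; last exact: (reparam_oo rpq).
by move/(reparam_oo (reparam_sym rpq)); rewrite (reparamK rpq).
Qed.

Lemma jacVM p q (t : R) : reparam p q -> 0 <= t <= 1 -> jac q (p t) * jac p t = 1.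
Proof.
move=> rpq t01; have rqp := reparam_sym rpq.
rewrite /jac (reparam_itv01 rpq t01); case: ifPn => [t01'|_]; last by rewrite mulr1.
have pt := reparam_oo rpq t01'.
have dp : is_derive t 1 p (derive1 p t).
  by rewrite derive1E; exact/derivableP/(reparam_derivable_oo rpq).
have dq : is_derive (p t) 1 q (derive1 q (p t)).
  by rewrite derive1E; exact/derivableP/(reparam_derivable_oo rqp).
have dqp := @is_derive1_comp _ q p t _ _ dq dp.
have : is_derive t 1 (@id R) (derive1 q (p t) * derive1 p t).
  apply: near_eq_is_derive dqp; exact: (reparam_near rpq).
by move=> h; have := @derive_val _ _ _ _ _ _ _ h; rewrite derive_id => <-.
Qed.

(** Monotonicity only gives a nonnegative derivative; [jacVM] excludes the value 0. *)
Lemma jac_gt0 p q (t : R) : reparam p q -> 0 <= t <= 1 -> 0 < jac p t.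
Proof.
move=> rpq t01; have J1 := jacVM rpq t01.
have J0 : jac p t != 0.
  by apply: contra_eq_neq J1 => ->; rewrite mulr0 eq_sym oner_neq0.
rewrite lt_neqAle eq_sym J0 /= /jac; case: ifPn => // t01'.
apply: (@incr_derive1_ge0_itv _ p true false 0 1).
- by move=> x; rewrite inE /= in_itv /= => x01; exact: (reparam_derivable_oo rpq).
- move=> x y; rewrite !in_itv /= => /andP[x0 _] /andP[_ y1] xy.
  exact: (reparam_lt rpq).
- by rewrite in_itv.
Qed.

Lemma reparam_lipschitz p q : reparam p q -> exists2 L : R, 0 <= L &
  forall s t, 0 <= s -> s <= t -> t <= 1 -> p s <= p t <= p s + L * (t - s).
Proof.
move=> rpq; have [g [dg cg pg]] := reparam_ext rpq.
have cg01 : {within `[0, 1], continuous (derive1 g)} by exact: continuous_subspaceT.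
(* The maximum of the extension's derivative bounds the increments from above; the absolute value
   makes the constant nonnegative. The lower bound on increments is monotonicity. *)
have [c _ cmax] := EVT_max (@ler01 R) cg01.
exists `|derive1 g c|; first exact: normr_ge0.
move=> s t s0 st t1; rewrite (reparam_le rpq)//=.
rewrite (pg s) ?s0 ?(le_trans st)//= (pg t) ?t1 ?andbT ?(le_trans s0)//.
have gd (x : R) : is_derive x 1 g (derive1 g x) by rewrite derive1E; exact/derivableP.
have [|x] := @MVT_segment _ g (derive1 g) s t st (fun x _ => gd x).
  by apply: derivable_within_continuous => x _; exact: dg.
rewrite in_itv /= => /andP[sx xt] gst; rewrite -lerBlDl gst ler_wpM2r ?subr_ge0//.
by rewrite (le_trans (cmax x _)) ?ler_norm// in_itv /= (le_trans s0)//= (le_trans xt).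
Qed.

Local Notation I01 := (`[0%R, 1%R]%classic : set R).

Lemma measurable_reparam p q : reparam p q -> measurable_fun I01 p.
Proof.
move=> rpq; have [g [dg _ pg]] := reparam_ext rpq.
apply: (eq_measurable_fun g) => [t|].
  by rewrite inE /= in_itv /= => /pg.
apply: measurable_funTS; apply: continuous_measurable_fun => t.
by apply: differentiable_continuous; exact/derivable1_diffP.
Qed.

Lemma measurable_jac p q : reparam p q -> measurable_fun I01 (jac p).
Proof.
move=> rpq; have [g [dg cg pg]] := reparam_ext rpq.
apply: (eq_measurable_fun (fun t : R => if 0 < t < 1 then derive1 g t else 1)) => [t _|].
  rewrite /jac; case: ifPn => // t01.
  by have [_ ->] := reparam_derivable rpq pg dg t01.
apply: measurable_funTS; apply: measurable_fun_ifT => //=.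
- by apply: measurable_and; apply: measurable_fun_ltr.
- exact: continuous_measurable_fun.
Qed.

End Reparametrization.

(** * The image of Lebesgue measure and the substitution rule *)

Section ChangeOfVariables.
Context {R : realType}.
Variables (p q : R -> R).
Hypothesis rpq : reparam p q.
Local Notation I01 := (`[0%R, 1%R]%classic : set R).
Local Notation mu := (@lebesgue_measure R).
Local Open Scope ereal_scope.

Let mI01 : measurable I01. Proof. exact: measurable_itv. Qed.

(** The fundamental theorem of calculus for the smooth extension, with which [jac p] agrees off the
    endpoints. The boolean covers both the whole of [0,1] and the left-open rays that generate the
    Borel sets. *)
Lemma integral_jac_itv (b : bool) (a : R) : (0 <= a <= 1)%R ->
  \int[mu]_(t in [set` Interval (BSide b a) (BRight 1%R)]) (jac p t)%:E =
  mu [set` Interval (BSide b (p a)) (BRight 1%R)].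
Proof.
move=> /andP[a0]; rewrite le_eqVlt => /predU1P[->|a1].
  rewrite (reparam1 rpq); case: b.
    by rewrite set_itv1 integral_set1 lebesgue_measure_set1.
  rewrite !set_itv_ge ?bnd_simp ?ltxx//.
  by rewrite integral_set0 measure0.
have [g [dg cg pg]] := reparam_ext rpq.
have jg : {in `]a, 1%R[%classic, forall t, (jac p t)%:E = (derive1 g t)%:E}.
  move=> t; rewrite inE /= in_itv /= => /andP[at0 t1].
  have t01 : (0 < t < 1)%R by rewrite t1 andbT (le_lt_trans a0).
  by have [_ <-] := reparam_derivable rpq pg dg t01; rewrite /jac t01.
have mg : measurable_fun (`]a, 1%R[%classic : set R) (EFin \o derive1 g).
  apply/measurable_EFinP; apply: measurable_funTS.
  exact: continuous_measurable_fun.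
rewrite integral_itv_bndoo; last by apply: eq_measurable_fun mg => t /jg.
transitivity (\int[mu]_(t in `]a, 1%R[) (derive1 g t)%:E); first exact: eq_integral.
have := @integral_itv_bndoo _ a 1%R _ true false mg; rewrite /comp => <-.
rewrite (@continuous_FTC2 _ _ g).
- have p1 : (p a < 1)%R.
    by rewrite -[ltRHS](reparam1 rpq) (reparam_lt rpq).
  rewrite lebesgue_measure_itv /= lte_fin p1 -EFinB -pg ?ler01 ?lexx//.
  by rewrite (reparam1 rpq) -pg// a0 ltW.
- exact: a1.
- exact: continuous_subspaceT.
- have gc x : g @ x --> g x.
    by apply: differentiable_continuous; exact/derivable1_diffP.
  split=> [x _| |]; first exact: dg.
    by apply: cvg_at_right_filter; exact: gc.
  by apply: cvg_at_left_filter; exact: gc.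
- by move=> x _.
Qed.

(** Extending [q] by the identity gives a measurable map of the whole line for which the preimage of
    [0,1] is exactly [0,1]. *)
Let Q (t : R) : R := if (0 <= t <= 1)%R then q t else t.

Let measurable_Q : measurable_fun setT Q.
Proof.
have [g [dg cg qg]] := reparam_ext (reparam_sym rpq).
rewrite (_ : Q = fun t => if (0 <= t <= 1)%R then g t else t); last first.
  by apply/funext => t; rewrite /Q; case: ifPn => // /qg.
apply: measurable_fun_ifT => //=.
- by apply: measurable_and; apply: measurable_fun_ler.
- apply: continuous_measurable_fun => t.
  by apply: differentiable_continuous; exact/derivable1_diffP.
Qed.

Let Q01 : Q @^-1` I01 = I01.
Proof.
apply/seteqP; split => t /=; rewrite /Q !in_itv /=.
  by case: ifPn => // /negP nt /nt.
by move=> t01; rewrite t01; exact: (reparam_inv01 rpq).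
Qed.

Let mQ A : measurable A -> measurable (I01 `&` Q @^-1` A).
Proof.
move=> mA; rewrite -[Q @^-1` A]setTI; apply: measurableI => //.
exact: measurable_Q.
Qed.

Let mjac : measurable_fun I01 (EFin \o jac p).
Proof. by apply/measurable_EFinP; exact: (measurable_jac rpq). Qed.

Let jac_ge0 t : I01 t -> 0 <= (jac p t)%:E.
Proof. by rewrite /= in_itv /= => t01; rewrite lee_fin ltW// (jac_gt0 rpq). Qed.

(* Both sides are finite measures in A, which agree on the rays ]x, +oo[ by the
   fundamental theorem of calculus. *)
Let pushforward_jac A : measurable A ->
  mu (I01 `&` Q @^-1` A) = \int[mu]_(t in A `&` I01) (jac p t)%:E.
Proof.
have caseT : mu (I01 `&` Q @^-1` setT) = \int[mu]_(t in setT `&` I01) (jac p t)%:E.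
  rewrite preimage_setT setIT setTI (integral_jac_itv true) ?lexx ?ler01//.
  by rewrite (reparam0 rpq).
rewrite -[X in X -> _]/(<<s @ocitv R >> A).
have -> : <<s @ocitv R >> = <<s @RGenOInfty.G R >>.
  by apply: RGenOInfty.measurableE.
apply: (@dynkin_induction _ (measurableTypeR R) _
  (fun A => mu (I01 `&` Q @^-1` A) = \int[mu]_(t in A `&` I01) (jac p t)%:E)).
- exact: RGenOInfty.measurableE.
- move=> _ _ [x ->] [y ->]; exists (Num.max x y).
  by apply/seteqP; split => z /=; rewrite !in_itv /= !andbT gt_max => /andP.
- exact: caseT.
- move=> _ [x ->].
  have [x0|x0] := ltP x 0%R.
    have -> : I01 `&` Q @^-1` `]x, +oo[ = I01 `&` Q @^-1` setT.
      apply/seteqP; split => t //= [t01 _]; split=> //.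
      move: t01; rewrite !in_itv /= andbT /Q => t01; rewrite t01.
      by have /andP[+ _] := reparam_inv01 rpq t01; exact: lt_le_trans.
    rewrite caseT; congr (integral _ _ _); rewrite setTI; apply/seteqP; split.
      move=> t /=; rewrite !in_itv /= andbT => /andP[t0 ->]; rewrite t0.
      by split=> //; exact: lt_le_trans t0.
    by move=> t [].
  have [x1|x1] := leP 1%R x.
    have -> : I01 `&` Q @^-1` `]x, +oo[ = set0.
      apply/seteqP; split => t //= []; rewrite !in_itv /= andbT /Q => t01.
      rewrite t01; have /andP[_ h] := reparam_inv01 rpq t01.
      by rewrite ltNge (le_trans h x1).
    rewrite (_ : _ `&` _ = set0); first by rewrite measure0 integral_set0.
    apply/seteqP; split => t //= []; rewrite !in_itv /= andbT => xt /andP[_ h].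
    by move: xt; rewrite ltNge (le_trans h x1).
  have x01 : (0 <= x <= 1)%R by rewrite x0 ltW.
  (* As [p] and [q] are increasing and mutually inverse, [x < q t] amounts to [p x < t]. *)
  have -> : I01 `&` Q @^-1` `]x, +oo[ = `]p x, 1%R]%classic.
    have /andP[px0 px1] := reparam01 rpq x01.
    apply/seteqP; split => t /=; rewrite !in_itv /= andbT /Q.
      move=> [t01]; rewrite t01 => xqt.
      have /andP[_ qt1] := reparam_inv01 rpq t01.
      rewrite -[in X in (_ < X)%R](reparamVK rpq t01) (reparam_lt rpq)//=.
      by case/andP: t01.
    move=> /andP[pxt t1].
    have t01 : (0 <= t <= 1)%R by rewrite t1 andbT (le_trans px0 (ltW pxt)).
    rewrite t01; split=> //.
    by rewrite -[ltLHS](reparamK rpq x01) (reparam_lt (reparam_sym rpq)).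
  rewrite -(integral_jac_itv false x01); congr (integral _ _ _).
  apply/seteqP; split => t /=; rewrite !in_itv /= andbT.
    by move=> /andP[xt t1]; rewrite xt t1 andbT; split=> //; rewrite (le_trans x0)// ltW.
  by move=> [-> /andP[_ ->]].
- move=> S mS PS.
  have caseT' := caseT; rewrite preimage_setT setIT setTI in caseT'.
  have EI : mu I01 = mu (I01 `&` Q @^-1` (~` S)) + mu (I01 `&` Q @^-1` S).
    have -> : I01 `&` Q @^-1` (~` S) = I01 `\` (I01 `&` Q @^-1` S).
      by rewrite preimage_setC setDIr setDv set0U setDE.
    have := measureDI mu mI01 (mQ mS).
    by rewrite [in X in _ = _ + X -> _]setIA setIid.
  have EJ : \int[mu]_(t in I01) (jac p t)%:E =
      \int[mu]_(t in ~` S `&` I01) (jac p t)%:E + \int[mu]_(t in S `&` I01) (jac p t)%:E.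
    rewrite -[in LHS](setTI I01) -(setvU S) setIUl ge0_integral_setU//.
    + by apply: measurableI => //; exact: measurableC.
    + exact: measurableI.
    + by rewrite -setIUl setvU setTI.
    + by move=> t; rewrite -setIUl setvU setTI => /jac_ge0.
    + apply/disj_setPLR => t [St _] [S't _]; exact: St.
  have := etrans (esym EI) (etrans caseT' EJ); rewrite PS.
  set x := mu _; set y := integral _ _ _; set z := integral _ _ _ => xy.
  (* Passing to the complement is a subtraction of extended reals, legitimate because the measures
     are finite on [0,1]. *)
  suff yfin : y \is a fin_num by rewrite -[LHS](addeK _ yfin) xy addeK.
  rewrite /y -PS ge0_fin_numE; last exact: measure_ge0.
  apply: (@le_lt_trans _ _ (mu I01)).
    by apply: le_measure; [rewrite inE; exact: mQ|rewrite inE|exact: subIsetl].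
  by rewrite lebesgue_measure_itv /= lte_fin ltr01 -EFinB ltry.
- move=> F mF tF PF.
  rewrite preimage_bigcup setI_bigcupr measure_semi_bigcup.
  + rewrite setI_bigcupl ge0_integral_bigcup//.
    * by apply: eq_eseriesr => i _; exact: PF.
    * by move=> k; exact: measurableI.
    * by rewrite -setI_bigcupl; apply: measurable_funS mjac => //; exact: subIsetr.
    * by move=> t; rewrite -setI_bigcupl => -[_ /jac_ge0].
    * exact: trivIset_setIr.
  + by move=> i; exact: (mQ (mF i)).
  + apply: trivIset_setIl; apply/trivIsetP => i j _ _ ij.
    by rewrite -preimage_setI; move/trivIsetP : tF => ->//; rewrite preimage_set0.
  + by apply: bigcup_measurable => i _; exact: (mQ (mF i)).
Qed.

(** The image of Lebesgue measure under [q] has density [jac p] on [0,1]. Integrating [f \o p]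
    against it gives the left side by the density formula and the right side by pushforward, since
    [p] undoes [q]. *)
Lemma ge0_integral_reparam (f : R -> \bar R) :
  measurable_fun I01 f -> (forall t, I01 t -> 0 <= f t) ->
  \int[mu]_(t in I01) (f (p t) * (jac p t)%:E) = \int[mu]_(t in I01) f t.
Proof.
move=> mf f0.
have mfp : measurable_fun I01 (f \o p).
  apply: (measurable_comp (F := I01)) => //.
    by move=> _ [t + <-] /=; rewrite !in_itv /=; exact: (reparam01 rpq).
  exact: (measurable_reparam rpq).
have fp0 t : I01 t -> 0 <= (f \o p) t.
  by move=> /=; rewrite !in_itv /= => /(reparam01 rpq) h; apply: f0; rewrite /= in_itv.
have mQ' : measurable_fun [set: measurableTypeR R] (Q : _ -> measurableTypeR R).
  exact: measurable_Q.
pose nu : {measure set (measurableTypeR R) -> \bar R} :=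
  measure_function_pushforward__canonical__measure_function_Measure mu mQ'.
transitivity (\int[nu]_(t in I01) (f \o p) t).
  apply/esym; apply: (@ge0_integral_density _ (measurableTypeR R)) => //.
  - exact: (measurable_jac rpq).
  - move=> A mA AI /=; rewrite /pushforward -[in RHS](setIidl AI) -pushforward_jac//.
    by rewrite -Q01 -preimage_setI (setIidr AI).
have fp0' : {in I01, forall t : measurableTypeR R, 0 <= (f \o p) t}.
  by move=> t /set_mem /fp0.
rewrite [LHS](ge0_integral_pushforward mQ' mu mI01 mfp fp0').
rewrite Q01; apply: eq_integral => t; rewrite inE /= in_itv /= => t01.
by rewrite /Q t01 (reparamVK rpq).
Qed.

End ChangeOfVariables.

Section ReparamConsequences.
Context {R : realType}.
Variables (p q : R -> R).
Hypothesis rpq : reparam p q.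
Local Notation I01 := (`[0%R, 1%R]%classic : set R).
Local Notation mu := (@lebesgue_measure R).

Lemma measurable_fun_reparam (f : R -> R) :
  measurable_fun I01 f -> measurable_fun I01 (f \o p).
Proof.
move=> mf; apply: (measurable_comp (F := I01)) => //.
  by move=> _ [t + <-] /=; rewrite !in_itv /=; exact: (reparam01 rpq).
exact: (measurable_reparam rpq).
Qed.

(** Multiplication by the nonnegative [jac p] commutes with taking positive and negative parts, to
    which the nonnegative case applies. *)
Lemma Rintegral_reparam (f : R -> R) : measurable_fun I01 f ->
  \int[mu]_(t in I01) (f (p t) * jac p t) = \int[mu]_(t in I01) f t.
Proof.
move=> mf; rewrite /Rintegral; congr (fine _).
have mEf : measurable_fun I01 (EFin \o f) by exact/measurable_EFinP.
have j0 t : t \in I01 -> 0 <= jac p t.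
  by rewrite inE /= in_itv /= => t01; rewrite ltW// (jac_gt0 rpq).
rewrite [LHS]integralE [RHS]integralE; congr (_ - _)%E.
- rewrite -[RHS](ge0_integral_reparam rpq)//; last exact: measurable_funepos.
  apply: eq_integral => t /j0 t0.
  by rewrite !funeposE /= -!EFin_max -EFinM maxr_pMl// mul0r.
- rewrite -[RHS](ge0_integral_reparam rpq)//; last exact: measurable_funeneg.
  apply: eq_integral => t /j0 t0.
  by rewrite !funenegE /= -!EFin_max -EFinM maxr_pMl// mul0r mulNr.
Qed.

(** Null sets pull back to null sets: the substitution rule for the indicator of the exceptional set
    [N] shows that the indicator at [p t] times [jac p t] has integral 0, and [jac p] is
    positive. *)
Lemma ae_reparam (P : R -> Prop) :
  {ae mu, forall t, I01 t -> P t} -> {ae mu, forall t, I01 t -> P (p t)}.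
Proof.
move=> [N [mN N0 PN]].
have mI : measurable I01 by exact: measurable_itv.
have m1 : measurable_fun I01 (\1_N : R -> R).
  by apply: measurable_funTS; exact: measurable_indic.
have E : (\int[mu]_(t in I01) `|(\1_N (p t) * jac p t)%:E| = 0)%E.
  transitivity (\int[mu]_(t in I01) ((EFin \o \1_N) (p t) * (jac p t)%:E))%E.
    apply: eq_integral => t; rewrite inE /= in_itv /= => t01.
    by rewrite /= ger0_norm// mulr_ge0// ltW// (jac_gt0 rpq).
  rewrite (ge0_integral_reparam rpq)//.
  - rewrite [LHS]integral_indic//; apply/eqP; rewrite -measure_le0 -N0.
    apply: le_measure; [rewrite inE; exact: measurableI|rewrite inE//|].
    exact: subIsetl.
  - exact/measurable_EFinP.
  - by move=> t _; rewrite lee_fin.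
move/ae_eq_integral_abs : E => /(_ mI).
have mj : measurable_fun I01 (EFin \o (fun t => \1_N (p t) * jac p t)).
  apply/measurable_EFinP; apply: measurable_funM.
    exact: (measurable_fun_reparam m1).
  exact: (measurable_jac rpq).
move=> /(_ mj); apply: filterS => t /= + t01.
move=> /(_ t01); have t01' : 0 <= t <= 1 by move: t01; rewrite in_itv.
move=> [] /eqP; rewrite mulf_eq0 (gt_eqF (jac_gt0 rpq t01')) orbF => /eqP n0.
apply: contrapT => nP; have : N (p t).
  apply: PN => /= h; apply/nP/h; rewrite in_itv /=; exact: (reparam01 rpq).
by move=> /mem_set; move: n0; rewrite indicE; case: (p t \in N) => // /eqP; rewrite oner_eq0.
Qed.

End ReparamConsequences.

(** In charts, fixing the first argument is restriction along the affine embedding sending [v] to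
    [(u0, v)], so [Ck_affine] applies. This serves both left multiplication in the group and the
    action on the quotient. *)
Lemma smooth_map_partial (R : realType) n m k (X Y Z : topologicalType)
    (A : manifold R n X) (B : manifold R m Y) (C : manifold R k Z)
    (op : X -> Y -> Z) (x : X) :
  (forall a b, @smooth_into R ('rV[R]_n * 'rV[R]_m)%type k Z C
    (fun uv => op (ichart A a uv.1) (ichart B b uv.2)) (img A a `*` img B b)) ->
  smooth_map B C (op x).
Proof.
move=> sop b; have [cf sf] := sop x b.
pose u0 := chart A x x.
pose f := fun uv : 'rV[R]_n * 'rV[R]_m => op (ichart A x uv.1) (ichart B b uv.2).
pose i (v : 'rV[R]_m) : 'rV[R]_n * 'rV[R]_m := (0, v).
have i_lin : linear i.
  move=> a u v; apply/eqP; rewrite xpair_eqE /=.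
  by rewrite scaler0 addr0 !eqxx.
pose iM := GRing.isLinear.Build _ _ _ _ _ i_lin.
pose iL : {linear 'rV[R]_m -> ('rV[R]_n * 'rV[R]_m)%type} := HB.pack i iM.
have ci : continuous iL.
  move=> v; exact: (@cvg_pair _ _ _ (nbhs v) (nbhs (0 : 'rV[R]_n)) (nbhs v)
    _ _ _ (fun=> 0) id (cvg_cst _) (@cvg_id _ (nbhs v))).
have fE v : op x (ichart B b v) = f ((u0, 0) + iL v).
  by rewrite /f /= addr0 add0r chartK//; exact: dom_center.
have ximg v : img B b v -> (img A x `*` img B b) ((u0, 0) + iL v).
  by move=> bv; split; rewrite /= ?addr0 ?add0r//; exact: chart_center_img.
have oAB : open (img A x `*` img B b).
  rewrite openE => -[u v] [/= Au Bv]; exists (img A x, img B b) => //=.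
  have oA : open (img A x) by exact: img_open.
  have oB : open (img B b) by exact: img_open.
  by split; apply: open_nbhs_nbhs.
split.
  move=> v bv; rewrite (_ : op x \o ichart B b = f \o (fun v => (u0, 0) + iL v)).
    apply: continuous_comp; first by apply: continuousD; [exact: cst_continuous|exact: ci].
    exact/cf/ximg.
  by apply/funext => w; exact: fE.
move=> y l.
rewrite (_ : chart C y \o _ = fun v => (chart C y \o f) ((u0, 0) + iL v)); last first.
  by apply/funext => w; rewrite /= fE.
apply: (Ck_sub _ (@Ck_affine _ l _ _ _ iL (u0, 0) (chart C y \o f)
  [set uv | (img A x `*` img B b) uv /\ dom C y (f uv)] _ ci (sf y l))).
- by move=> v [bv dv]; split; [exact: ximg|rewrite /= -fE].
- by apply: open_preimage_on => //; exact: dom_open.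
Qed.

(** * Transport of the metric and of the distance *)

Section Coordinates.
Context {R : realType} {n : nat}.
Local Notation I01 := (`[0%R, 1%R]%classic : set R).

Definition measurable_coords (q : R -> 'rV[R]_n) : Prop :=
  forall j, measurable_fun I01 (fun t => q t 0 j).

Lemma measurable_coordsZ (a : R) (q : R -> 'rV[R]_n) :
  measurable_coords q -> measurable_coords (fun t => a *: q t).
Proof.
move=> mq j; rewrite (_ : (fun t => _) = fun t => a * q t 0 j).
  exact: measurable_funM.
by apply/funext => t; rewrite !mxE.
Qed.

Lemma measurable_coordsB (q1 q2 : R -> 'rV[R]_n) :
  measurable_coords q1 -> measurable_coords q2 ->
  measurable_coords (fun t => q1 t - q2 t).
Proof.
move=> m1 m2 j; rewrite (_ : (fun t => _) = fun t => q1 t 0 j - q2 t 0 j).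
  exact: measurable_funB.
by apply/funext => t; rewrite !mxE.
Qed.

Lemma measurable_coords_linear (L : {linear 'rV[R]_n -> 'rV[R]_n}) q :
  measurable_coords q -> measurable_coords (fun t => L (q t)).
Proof.
move=> mq j.
rewrite (_ : (fun t => _) = fun t => \sum_i q t 0 i * L (delta_mx 0 i) 0 j).
  by apply: measurable_sum => i; apply: measurable_funM.
apply/funext => t; rewrite {1}(row_sum_delta (q t)) linear_sum summxE.
by apply: eq_bigr => i _; rewrite linearZ mxE.
Qed.

Context (G : topologicalType) (AG : manifold R n G).
Variable g : G -> 'rV[R]_n -> 'rV[R]_n -> R.
Hypothesis hg : riemannian_metric AG g.

Lemma metricDl x (a : R) u v w : g x (a *: u + v) w = a * g x u w + g x v w.
Proof. by case: hg. Qed.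

Lemma metricC x u v : g x u v = g x v u.
Proof. by case: hg. Qed.

Lemma metric0l x w : g x 0 w = 0.
Proof. by have := metricDl x 1 0 0 w; rewrite scaler0 addr0 mul1r => E; lra. Qed.

Lemma metricZl x (a : R) u w : g x (a *: u) w = a * g x u w.
Proof. by rewrite -[a *: u]addr0 metricDl metric0l addr0. Qed.

Lemma metricZ x (a b : R) u w : g x (a *: u) (b *: w) = a * b * g x u w.
Proof. by rewrite metricZl metricC metricZl metricC mulrA. Qed.

Lemma metric_suml x k (F : 'I_k -> 'rV[R]_n) w :
  g x (\sum_i F i) w = \sum_i g x (F i) w.
Proof.
elim: k F => [|k IH] F; first by rewrite !big_ord0 metric0l.
by rewrite !big_ord_recl -[F ord0]scale1r metricDl mul1r scale1r IH.
Qed.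

(** The Gram matrix expansion, which reduces measurability of a pairing to measurability of
    coordinates. *)
Lemma metricE x u v : g x u v =
  \sum_i \sum_j u 0 i * v 0 j * g x (delta_mx 0 i) (delta_mx 0 j).
Proof.
rewrite {1}(row_sum_delta u) metric_suml; apply: eq_bigr => i _.
rewrite metricZl metricC {1}(row_sum_delta v) metric_suml mulr_sumr.
by apply: eq_bigr => j _; rewrite metricZl mulrA metricC.
Qed.

Lemma metric_ge0 x u : 0 <= g x u u.
Proof.
have [->|u0] := eqVneq u 0; first by rewrite metric0l.
by case: hg => _ _ /(_ x u u0)/ltW.
Qed.

Lemma measurable_metric x q1 q2 : measurable_coords q1 -> measurable_coords q2 ->
  measurable_fun I01 (fun t => g x (q1 t) (q2 t)).
Proof.
move=> m1 m2; rewrite (_ : (fun t => _) = fun t => \sum_i \sum_j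
    q1 t 0 i * q2 t 0 j * g x (delta_mx 0 i) (delta_mx 0 j)); last first.
  by apply/funext => t; exact: metricE.
apply: measurable_sum => i; apply: measurable_sum => j.
by apply: measurable_funM => //; apply: measurable_funM.
Qed.

End Coordinates.

Section Transport.
Context {R : realType} (n m : nat) (G : TopGroup.type) (AG : manifold R n G).
Context (K : set G) (M : topologicalType) (AM : manifold R m M) (pi : G -> M).
Variable g : G -> 'rV[R]_n -> 'rV[R]_n -> R.
Hypothesis hG : lie_group AG.
Local Notation P := (G * (R -> 'rV[R]_n))%type.
Local Notation TP := ('rV[R]_n * (R -> 'rV[R]_n))%type.

(* The action of a symmetry on P = G x L^2 is a product (phi, tau), covering a
   map F of AC([0,1], M). *)
Record transport (F : (R -> M) -> (R -> M)) (phi : G -> G)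
    (tau : (R -> 'rV[R]_n) -> (R -> 'rV[R]_n)) : Prop := Transport {
  tr_smooth : smooth_map AG AG phi;
  tr_iso : forall x u v,
    g (phi x) (dmap AG AG phi x u) (dmap AG AG phi x v) = g x u v;
  tr_mul : forall x y, phi (x * y)%g = (phi x * y)%g;
  tr_lin : forall (a : R) f h,
    tau (fun t => a *: f t + h t) = fun t => a *: tau f t + tau h t;
  tr_linear : forall (L : {linear 'rV[R]_n -> 'rV[R]_n}) f,
    tau (fun t => L (f t)) = fun t => L (tau f t);
  tr_L2perp : forall f, L2perp AG K g f -> L2perp AG K g (tau f);
  tr_inner : forall f h, measurable_coords f -> measurable_coords h ->
    L2inner g (tau f) (tau h) = L2inner g f h;
  tr_normsq : forall f, measurable_coords f ->
    L2normsq g (tau f) = L2normsq g f;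
  tr_projects : forall p beta, projects AG K pi g p beta ->
    projects AG K pi g (phi p.1, tau p.2) (F beta);
  tr_AC : forall beta, AC_curve AM beta -> AC_curve AM (F beta) }.

(** The equality of curves and of L^2 representatives that matters: composing with [p] and then with
    its inverse restores a function on [0,1] only. *)
Definition eq01 T (f h : R -> T) := forall t, 0 <= t <= 1 -> f t = h t.

Record transport_pair F phi tau F' phi' tau' : Prop := TransportPair {
  trp : transport F phi tau;
  trp_inv : transport F' phi' tau';
  trp_phiK : cancel phi phi';
  trp_phiVK : cancel phi' phi;
  trp_tauK : forall f, eq01 (tau' (tau f)) f;
  trp_tauVK : forall f, eq01 (tau (tau' f)) f;
  trp_FK : forall beta, eq01 (F' (F beta)) beta;
  trp_FVK : forall beta, eq01 (F (F' beta)) beta }.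

Lemma transport_pair_sym F phi tau F' phi' tau' :
  transport_pair F phi tau F' phi' tau' -> transport_pair F' phi' tau' F phi tau.
Proof. by case=> *; split. Qed.

Lemma L2perp_measurable q : L2perp AG K g q -> measurable_coords q.
Proof. by case. Qed.

Lemma L2normsq_eq01 q q' : eq01 q q' -> L2normsq g q = L2normsq g q'.
Proof.
move=> qq; apply: eq_integral => t; rewrite inE /= in_itv /= => t01.
by rewrite qq.
Qed.

Lemma L2inner_eq01 q1 q2 q1' q2' : eq01 q1 q1' -> eq01 q2 q2' ->
  L2inner g q1 q2 = L2inner g q1' q2'.
Proof.
move=> qq1 qq2; apply: eq_Rintegral => t; rewrite inE /= in_itv /= => t01.
by rewrite qq1// qq2.
Qed.

Lemma projects_eq01 p beta beta' : eq01 beta beta' ->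
  projects AG K pi g p beta -> projects AG K pi g p beta'.
Proof.
move=> bb [alpha [a1 a2 a3 a4 a5]]; exists alpha; split=> // t t01.
by rewrite -bb// a5.
Qed.

Section OneTransport.
Variables (F F' : (R -> M) -> (R -> M)) (phi phi' : G -> G).
Variables (tau tau' : (R -> 'rV[R]_n) -> (R -> 'rV[R]_n)).
Hypothesis tp : transport_pair F phi tau F' phi' tau'.
Let tr := trp tp.
Let tr' := trp_inv tp.

Let Phi (p : P) : P := (phi p.1, tau p.2).
Let dPhi (p : P) (v : TP) : TP := (dmap AG AG phi p.1 v.1, tau v.2).

Lemma tauB f h : tau (fun t => f t - h t) = fun t => tau f t - tau h t.
Proof.
have E : (fun t => f t - h t) = (fun t => (-1) *: h t + f t).
  by apply/funext => t; rewrite scaleN1r addrC.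
by rewrite E (tr_lin tr); apply/funext => t; rewrite scaleN1r addrC.
Qed.

Lemma tauZ a f : tau (fun t => a *: f t) = fun t => a *: tau f t.
Proof.
(* Linearity with coefficient -1 at zero functions gives tau 0 = - tau 0 + tau 0. *)
have t0 : tau (fun=> 0) = fun=> 0.
  have := tr_lin tr (-1) (fun=> 0) (fun=> 0).
  under eq_fun do rewrite scaler0 addr0; move=> E.
  rewrite E; apply/funext => t; rewrite scaleN1r addNr//.
have E : (fun t => a *: f t) = (fun t => a *: f t + (fun=> 0) t).
  by apply/funext => t; rewrite addr0.
by rewrite E (tr_lin tr) t0; apply/funext => t; rewrite addr0.
Qed.

(** By linearity tau maps the remainder of a difference quotient to that of the transported curve,
    with the same L^2 norm. Preservation of the norm is available for measurable functions, whence
    the measurability assumptions near [s]. *)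
Lemma L2_derivative_transport q s q' :
  (\forall h \near (0 : R)^', measurable_coords (q (s + h))) ->
  measurable_coords (q s) -> measurable_coords q' ->
  L2_derivative g q s q' -> L2_derivative g (tau \o q) s (tau q').
Proof.
move=> mq mqs mq'; rewrite /L2_derivative; apply: cvg_trans.
apply: near_eq_cvg; apply: filterS mq => h mqh /=.
rewrite -[LHS](tr_normsq tr); first by rewrite tauB tauZ tauB.
by apply: measurable_coordsB => //; apply: measurable_coordsZ; exact: measurable_coordsB.
Qed.

Lemma P_smooth_curve_transport c (I : set R) : open I ->
  P_smooth_curve AG K g c I -> P_smooth_curve AG K g (Phi \o c) I.
Proof.
move=> oI [sc [D [D0 Ds]]]; split.
  exact: (smooth_into_comp oI (tr_smooth tr) sc).
exists (fun k s => tau (D k s)); split=> [s Is|k s Is]; first by rewrite D0.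
have [Ls ds] := Ds k s Is; split; first exact: (tr_L2perp tr).
apply: L2_derivative_transport ds.
- have : \forall h \near (0 : R), I (s + h).
    have /continuousP/(_ I oI) : continuous (fun h : R => s + h).
      by move=> h; apply: continuousD; [exact: cst_continuous|].
    by rewrite openE; apply; rewrite /= addr0.
  move=> /nbhs_dnbhs; apply: filterS => h Ish.
  by have [/L2perp_measurable] := Ds k _ Ish.
- exact: L2perp_measurable Ls.
- by have [/L2perp_measurable] := Ds k.+1 s Is.
Qed.

Lemma smooth_AC_path_transport B :
  smooth_AC_path AG K AM pi g B -> smooth_AC_path AG K AM pi g (F \o B).
Proof.
move=> [aB lB]; split=> [s|s0]; first exact/(tr_AC tr)/aB.
have [e e0 [c sc pc]] := lB s0; exists e => //; exists (Phi \o c).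
  by apply: P_smooth_curve_transport => //; exact: ball_open.
by move=> s /pc; exact: (tr_projects tr).
Qed.

Lemma lifted_velocity_transport B p v :
  lifted_velocity AG K pi g B p v ->
  lifted_velocity AG K pi g (F \o B) (Phi p) (dPhi p v).
Proof.
move=> [e e0 [c [sc c0 [v1 v2] Lv pc]]]; exists e => //; exists (Phi \o c).
have b0 : ball 0 e (0 : R) by exact: ballxx.
split.
- by apply: P_smooth_curve_transport => //; exact: ball_open.
- by rewrite /= c0.
- split.
    have [[cc _] _] := sc.
    have ct : {for 0, continuous (fst \o c)} by exact: cc.
    have := velocity_diffeo (tr_smooth tr) (tr_smooth tr') (trp_phiK tp) ct.
    by rewrite v1 /= c0.
  apply: (L2_derivative_transport (q := snd \o c)) v2.
  + have : \forall h \near (0 : R), ball 0 e h by exact: nbhsx_ballx.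
    move=> /nbhs_dnbhs; apply: filterS => h; rewrite /= add0r => /pc[_ [_ _ L _ _]].
    exact: L2perp_measurable L.
  + by have [? [_ _ L _ _]] := pc _ b0; exact: L2perp_measurable L.
  + exact: L2perp_measurable Lv.
- exact: (tr_L2perp tr).
- by move=> s /pc; exact: (tr_projects tr).
Qed.

Lemma dphiK x u : dmap AG AG phi' (phi x) (dmap AG AG phi x u) = u.
Proof.
rewrite -(dmap_comp _ _ (tr_smooth tr) (tr_smooth tr')).
by apply: dmap_id => y; exact: (trp_phiK tp).
Qed.

Lemma smooth_curve_continuous (y : R -> G) s : smooth_curve AG y setT ->
  {for s, continuous y}.
Proof. by move=> [+ _]; apply. Qed.

Lemma mul_continuous_at (y : R -> G) (x : G) s : {for s, continuous y} ->
  {for s, continuous (fun t => x * y t)%g}.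
Proof.
move=> cy; apply: (@continuous_comp _ _ _ y (fun z => x * z)%g) => //.
exact: (smooth_map_continuous (smooth_map_partial x (hG.1))).
Qed.

(** The adjoint action in bundled form, so that [tr_linear] moves tau past it. *)
Let Ad_lin (y : G) : {linear 'rV[R]_n -> 'rV[R]_n} :=
  'd (chart AG (y * 1 * y^-1)%g \o (fun x => y * x * y^-1)%g \o ichart AG 1%g)
    (chart AG 1%g 1%g).

(** The remainder of the difference quotient along an orbit: [a] stands for the inverse of the
    increment, [L] and [L'] for the adjoint actions at the two parameter values. *)
Let L2_Ad_transport (f w : R -> 'rV[R]_n) (a : R)
    (L L' : {linear 'rV[R]_n -> 'rV[R]_n}) :
  measurable_coords f -> measurable_coords w ->
  L2normsq g (fun t => a *: (L (tau f t) - L' (tau f t)) - tau w t) =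
  L2normsq g (fun t => a *: (L (f t) - L' (f t)) - w t).
Proof.
move=> mf mw; rewrite -[RHS](tr_normsq tr).
  by rewrite tauB tauZ tauB (tr_linear tr) (tr_linear tr).
apply: measurable_coordsB => //; apply: measurable_coordsZ.
by apply: measurable_coordsB; exact: measurable_coords_linear.
Qed.

(** The same curve [y] in [K] works at the image point, because phi commutes with right translations
    and tau with the adjoint action. *)
Lemma vertical_transport p w : measurable_coords p.2 ->
  vertical AG K g p w -> vertical AG K g (Phi p) (dPhi p w).
Proof.
move=> mp [Lw [y [sy Ky y0 [v1 v2]]]]; split; first exact: (tr_L2perp tr).
exists y; split=> //; split.
- have cy : {for 0, continuous (fun s => p.1 * y s)%g}.
    exact/mul_continuous_at/smooth_curve_continuous.
  have := velocity_diffeo (tr_smooth tr) (tr_smooth tr') (trp_phiK tp) cy.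
  rewrite y0 mulg1 => E.
  have -> : fst \o (fun s => K_action AG (Phi p) (y s)) = phi \o (fun s => p.1 * y s)%g.
    by apply/funext => s; rewrite /K_action /= (tr_mul tr).
  by rewrite [LHS]E /= -v1.
- move: v2; rewrite /L2_derivative; apply: cvg_trans; apply: near_eq_cvg.
  apply: nearW => h /=; apply: esym.
  exact: (L2_Ad_transport _ (Ad_lin _) (Ad_lin _) mp (L2perp_measurable Lw)).
Qed.

End OneTransport.

Section TwoTransports.
Variables (F F' : (R -> M) -> (R -> M)) (phi phi' : G -> G).
Variables (tau tau' : (R -> 'rV[R]_n) -> (R -> 'rV[R]_n)).
Hypothesis tp : transport_pair F phi tau F' phi' tau'.
Let tr := trp tp.
Let tr' := trp_inv tp.
Let tp' := transport_pair_sym tp.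
Let Phi (p : P) : P := (phi p.1, tau p.2).
Let dPhi (p : P) (v : TP) : TP := (dmap AG AG phi p.1 v.1, tau v.2).

(** Needed because a round trip by tau and its inverse returns the base point and the vector only up
    to equality on [0,1]. *)
Lemma vertical_eq01 p p' w w' : p.1 = p'.1 -> w.1 = w'.1 ->
  eq01 p.2 p'.2 -> eq01 w.2 w'.2 -> L2perp AG K g w'.2 ->
  vertical AG K g p w -> vertical AG K g p' w'.
Proof.
move=> p1 w1 p2 w2 Lw' [_ [y [sy Ky y0 [v1 v2]]]]; split=> //.
exists y; split=> //; split; first by rewrite -w1 -v1 /comp /K_action /= p1.
move: v2; rewrite /L2_derivative; apply: cvg_trans; apply: near_eq_cvg.
apply: nearW => h /=; apply: L2normsq_eq01 => t t01 /=.
by rewrite p2// w2.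
Qed.

Lemma P_inner_transport p v w : measurable_coords v.2 -> measurable_coords w.2 ->
  P_inner g (Phi p) (dPhi p v) (dPhi p w) = P_inner g p v w.
Proof.
by move=> mv mw; rewrite /P_inner /= (tr_iso tr) (tr_inner tr).
Qed.

(** A vertical vector [w] at the image point is pulled back to a vertical [w'] at [p] by the inverse
    transport; as the lift preserves inner products, orthogonality to [w'] gives orthogonality to
    [w]. *)
Lemma horizontal_transport p h : measurable_coords p.2 -> L2perp AG K g p.2 ->
  horizontal AG K g p h -> horizontal AG K g (Phi p) (dPhi p h).
Proof.
move=> mp Lp [Lh hp]; split; first exact: (tr_L2perp tr).
move=> w vw; have [Lw _] := vw.
have LP := tr_L2perp tr Lp.
have mP : measurable_coords (Phi p).2 := L2perp_measurable LP.
have vw' := vertical_transport tp' mP vw.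
pose w' : TP := (dmap AG AG phi' (phi p.1) w.1, tau' w.2).
have Lw' : L2perp AG K g w'.2 by exact: (tr_L2perp tr').
have vpw' : vertical AG K g p w'.
  apply: vertical_eq01 vw' => //=; first exact: (trp_phiK tp).
  exact: (trp_tauK tp).
rewrite -[RHS](hp _ vpw') -(P_inner_transport p).
- rewrite /P_inner /=; congr (_ + _); first congr (g _ _ _).
    by have := dphiK tp' (phi p.1) w.1; rewrite (trp_phiK tp).
  by apply: L2inner_eq01 => // t t01; rewrite (trp_tauVK tp).
- exact: L2perp_measurable Lh.
- exact: L2perp_measurable Lw'.
Qed.

Lemma horizontal_part_transport p v h : measurable_coords p.2 -> L2perp AG K g p.2 ->
  horizontal_part AG K g p v h -> horizontal_part AG K g (Phi p) (dPhi p v) (dPhi p h).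
Proof.
move=> mp Lp [hh vv]; split; first exact: horizontal_transport.
have := vertical_transport tp mp vv.
by rewrite /= /dmap linearB /= (tauB tp).
Qed.

Lemma AC_metric_transport B1 B2 r :
  AC_metric AG K pi g B1 B2 r -> AC_metric AG K pi g (F \o B1) (F \o B2) r.
Proof.
move=> [p [v1 [v2 [h1 [h2 [[l1 l2] hp1 hp2 ->]]]]]].
have Lp : L2perp AG K g p.2.
  have [e e0 [c [_ c0 _ _ pc]]] := l1.
  by have [? [_ _ + _ _]] := pc 0 (ballxx 0 e0); rewrite c0.
have mp := L2perp_measurable Lp.
exists (Phi p), (dPhi p v1), (dPhi p v2), (dPhi p h1), (dPhi p h2); split.
- by split; exact: (lifted_velocity_transport tp).
- exact: horizontal_part_transport.
- exact: horizontal_part_transport.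
- have [[/L2perp_measurable m1 _] _] := hp1.
  have [[/L2perp_measurable m2 _] _] := hp2.
  by rewrite P_inner_transport.
Qed.

Lemma AC_metric_eq01 B1 B2 B1' B2' r :
  (forall s, eq01 (B1 s) (B1' s)) -> (forall s, eq01 (B2 s) (B2' s)) ->
  AC_metric AG K pi g B1 B2 r -> AC_metric AG K pi g B1' B2' r.
Proof.
move=> E1 E2 [p [v1 [v2 [h1 [h2 [[l1 l2] hp1 hp2 rE]]]]]].
exists p, v1, v2, h1, h2; split=> //; split.
  have [e e0 [c [c1 c2 c3 c4 pc]]] := l1; exists e => //; exists c; split=> // s /pc.
  exact/projects_eq01/E1.
have [e e0 [c [c1 c2 c3 c4 pc]]] := l2; exists e => //; exists c; split=> // s /pc.
exact/projects_eq01/E2.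
Qed.

Lemma curve_length_transport (c : R -> G) : smooth_curve AG c setT ->
  curve_length AG g (phi \o c) = curve_length AG g c.
Proof.
move=> sc; rewrite /curve_length; apply: eq_integral => t _; apply: (congr1 EFin).
have ct : {for (t : R), continuous c} by exact: smooth_curve_continuous.
rewrite (velocity_diffeo (tr_smooth tr) (tr_smooth tr') (trp_phiK tp) ct).
by rewrite /tnorm /= (tr_iso tr).
Qed.

(** Composition with phi sends competing curves to competing curves of the same length. The reverse
    inequality follows by applying this to the inverse pair. *)
Lemma geodesic_dist_transport_le x y :
  (geodesic_dist AG g (phi x) (phi y) <= geodesic_dist AG g x y)%E.
Proof.
apply/ereal_infP => _ [c [sc c0 c1] <-]; apply: ereal_inf_lbound.
exists (phi \o c); last exact: curve_length_transport.
split; first exact: (smooth_into_comp openT (tr_smooth tr) sc).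
  by rewrite /= c0.
by rewrite /= c1.
Qed.

End TwoTransports.

Section Preservation.
Variables (F F' : (R -> M) -> (R -> M)) (phi phi' : G -> G).
Variables (tau tau' : (R -> 'rV[R]_n) -> (R -> 'rV[R]_n)).
Hypothesis tp : transport_pair F phi tau F' phi' tau'.
Let tr := trp tp.
Let tp' := transport_pair_sym tp.
Let Phi (p : P) : P := (phi p.1, tau p.2).

Lemma geodesic_dist_transport x y :
  geodesic_dist AG g (phi x) (phi y) = geodesic_dist AG g x y.
Proof.
apply/eqP; rewrite eq_le (geodesic_dist_transport_le tp) /=.
by have := geodesic_dist_transport_le tp' (phi x) (phi y); rewrite !(trp_phiK tp).
Qed.

(** The infima agree term by term: for each [y] in [K] the lift commutes with the action of [y], and
    both summands are preserved. *)
Lemma orbit_dist_transport p1 p2 : measurable_coords p1.2 -> measurable_coords p2.2 ->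
  orbit_dist AG K g (Phi p1) (Phi p2) = orbit_dist AG K g p1 p2.
Proof.
move=> m1 m2; congr ereal_inf; apply: eq_imagel => y Ky; congr (sqrte (_ ^+ 2 + _))%E.
  by rewrite /K_action /= -(tr_mul tr) geodesic_dist_transport.
rewrite -[RHS](tr_normsq tr); last first.
  by apply: measurable_coordsB => //; exact: measurable_coords_linear.
by rewrite (tauB tp) /K_action /= (tr_linear tr).
Qed.

End Preservation.

(** Lifts of the curves are carried to lifts of their images with the same orbit distance; other
    lifts of the images are dealt with by the inverse pair. *)
Lemma AC_dist_transport_le F F' phi phi' tau tau' beta1 beta2 :
  transport_pair F phi tau F' phi' tau' ->
  (AC_dist AG K pi g (F beta1) (F beta2) <= AC_dist AG K pi g beta1 beta2)%E.
Proof.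
move=> tp; apply/ereal_infP => _ [[p1 p2] [/= pr1 pr2] <-].
apply: ereal_inf_lbound.
exists ((phi p1.1, tau p1.2), (phi p2.1, tau p2.2)) => /=.
  by split; apply: (tr_projects (trp tp)).
apply: (orbit_dist_transport tp).
  by have [? [_ _ L _ _]] := pr1; exact: L2perp_measurable L.
by have [? [_ _ L _ _]] := pr2; exact: L2perp_measurable L.
Qed.

Lemma AC_dist_eq01 beta1 beta2 beta1' beta2' :
  eq01 beta1 beta1' -> eq01 beta2 beta2' ->
  AC_dist AG K pi g beta1 beta2 = AC_dist AG K pi g beta1' beta2'.
Proof.
move=> E1 E2; congr (ereal_inf (_ @` _)); apply/seteqP; split => -[p1 p2] /= [].
  by move=> pr1 pr2; split; [exact: projects_eq01 pr1|exact: projects_eq01 pr2].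
move=> pr1 pr2; split; [apply: projects_eq01 pr1|apply: projects_eq01 pr2].
  by move=> t /E1.
by move=> t /E2.
Qed.

Lemma transport_preserves F F' phi phi' tau tau' :
  transport_pair F phi tau F' phi' tau' ->
  preserves_metric_and_dist AG K AM pi g F.
Proof.
move=> tp; have tp' := transport_pair_sym tp; split.
- exact: (tr_AC (trp tp)).
- by move=> B; exact: (smooth_AC_path_transport tp).
- move=> B1 B2 r _ _ _; split; last exact: (AC_metric_transport tp).
  (* The converse transports back by the inverse pair, and the round trip restores each curve on
     [0,1]. *)
  move=> /(AC_metric_transport tp'); apply: AC_metric_eq01 => s;
    exact: (trp_FK tp).
- move=> beta1 beta2 _ _; apply/eqP; rewrite eq_le (AC_dist_transport_le _ _ tp) /=.
  have := AC_dist_transport_le (F beta1) (F beta2) tp'.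
  by rewrite (AC_dist_eq01 (trp_FK tp _) (trp_FK tp _)).
Qed.

End Transport.

(** * Left translations *)

Section ACContinuity.
Context {R : realType}.
Local Notation I01 := (`[0%R, 1%R]%classic : set R).
Local Notation mu := (@lebesgue_measure R).

(** Only interior times: at 0 and 1 absolute continuity on [0,1] controls one side, whereas
    continuity on the line is two-sided. *)
Lemma AC_curve_continuous n (X : topologicalType) (A : manifold R n X)
    (c : R -> X) (t : R) :
  AC_curve A c -> 0 < t < 1 -> {for t, continuous c}.
Proof.
move=> ac /andP[t0 t1]; have t01 : 0 <= t <= 1 by rewrite !ltW.
have [e e0 [dc acc]] := ac t t01.
have tw : Num.max 0 (t - e) <= t <= Num.min 1 (t + e).
  by rewrite ge_max le_min !(ltW t0, ltW t1) /= lerBlDr lerDl ltW.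
have win : \forall s \near t, Num.max 0 (t - e) <= s <= Num.min 1 (t + e).
  near=> s; rewrite ge_max le_min -!andbA; apply/and4P; split.
  - by apply: ltW; near: s; exact: lt_nbhsr.
  - by apply: ltW; near: s; apply: lt_nbhsr; rewrite ltrBlDr ltrDl.
  - by apply: ltW; near: s; exact: lt_nbhsl.
  - by apply: ltW; near: s; apply: lt_nbhsl; rewrite ltrDl.
have cc : {for t, continuous (fun s => chart A (c t) (c s))}.
  apply/cvgrPdist_lt => eps eps0.
  have [d d0 unif] := abs_continuous_unif eps0 acc.
  have nd : \forall s \near t, `|s - t| < d.
    by apply/nbhs_ballP; exists d => // s; rewrite /ball /= distrC.
  apply: filterS2 win nd => s sw sd; rewrite distrC; exact: unif.
have E : \forall s \near t, (ichart A (c t) \o (fun s => chart A (c t) (c s))) s = c s.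
  by apply: filterS win => s sw /=; rewrite chartK//; exact: dc.
rewrite /prop_for /continuous_at -(nbhs_singleton E).
apply: cvg_trans; first exact: (near_eq_cvg E).
by apply: continuous_comp => //; apply: ichart_continuous; exact: chart_center_img.
Unshelve. all: by end_near. Qed.

Lemma ae_interior : {ae mu, forall t, I01 t -> 0 < t < 1}.
Proof.
exists [set 0; 1]; split.
- by apply: measurableU; exact: measurable_set1.
- by apply: countable_lebesgue_measure0; apply: finite_set_countable; exact: finite_set2.
- move=> t /=; apply: contra_notP => /not_orP[t0 t1].
  rewrite in_itv /= => /andP[h0 h1]; apply/andP; split.
    by rewrite lt_neqAle h0 andbT eq_sym; apply/eqP.
  by rewrite lt_neqAle h1 andbT; apply/eqP.
Qed.

(** The endpoints form a null set, so almost-everywhere statements can be verified at interior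
    times, where curves are continuous and reparametrizations derivable. *)
Lemma ae01_sub (P Q : R -> Prop) : (forall t, 0 < t < 1 -> P t -> Q t) ->
  {ae mu, forall t, I01 t -> P t} -> {ae mu, forall t, I01 t -> Q t}.
Proof.
move=> PQ aP.
have := negligibleU aP ae_interior; apply: negligibleS => t /= nQ.
have [It nQt] := (not_implyP _ _).1 nQ.
apply: contrapT => /not_orP[/contrapT Pt /contrapT t01].
by apply: nQt; apply: PQ; [exact: t01|exact: Pt].
Qed.

End ACContinuity.

Section LeftTranslation.
Context (R : realType) (n m : nat) (G : TopGroup.type) (AG : manifold R n G).
Context (K : set G) (M : topologicalType) (AM : manifold R m M).
Context (pi : G -> M) (act : G -> M -> M).
Context (g : G -> 'rV[R]_n -> 'rV[R]_n -> R).
Hypothesis hG : lie_group AG.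
Hypothesis hM : homogeneous_space AG K AM pi act.
Hypothesis hgL : left_invariant AG g setT.

Lemma smooth_mulgl a : smooth_map AG AG (fun x : G => a * x)%g.
Proof. exact: (smooth_map_partial a hG.1). Qed.

Lemma smooth_act a : smooth_map AM AM (act a).
Proof. by case: hM => _ [_ [_ [_ [sact _]]]]; exact: (smooth_map_partial a sact). Qed.

Lemma dL_comp a b x u : dL AG b (a * x)%g (dL AG a x u) = dL AG (b * a)%g x u.
Proof.
have E : (fun z => b * z)%g \o (fun z => a * z)%g = (fun z : G => b * a * z)%g.
  by apply/funext => z; rewrite /= mulgA.
by rewrite /dL -E (dmap_comp x u (smooth_mulgl a) (smooth_mulgl b)).
Qed.

Lemma dL1 x u : dL AG 1%g x u = u.
Proof. by apply: dmap_id => z; rewrite mul1g. Qed.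

Lemma dLK a x u : dL AG a^-1%g (a * x)%g (dL AG a x u) = u.
Proof. by rewrite dL_comp mulVg dL1. Qed.

Lemma dL_eq0 a x u : (dL AG a x u == 0) = (u == 0).
Proof.
apply/eqP/eqP => [|->]; last exact: linear0.
by move=> E; rewrite -(dLK a x u) E; exact: linear0.
Qed.

Lemma velocity_mulgl a c t : {for t, continuous c} ->
  velocity AG (fun s => a * c s)%g t = dL AG a (c t) (velocity AG c t).
Proof. exact: (velocity_diffeo (smooth_mulgl a) (smooth_mulgl a^-1%g) (mulKg a)). Qed.

(** Translating a curve in the coset of [a * x] by the inverse of [a] gives a curve in the coset of
    [x], whose velocity is the required [u]. *)
Lemma tangent_to_mulgl a x w :
  tangent_to AG [set z | K ((a * x)^-1 * z)%g] (a * x)%g w ->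
  exists2 u, tangent_to AG [set z | K (x^-1 * z)%g] x u & w = dL AG a x u.
Proof.
move=> [c [sc Kc c0 vc]]; exists (dL AG a^-1%g (a * x)%g w).
  exists (fun s => a^-1 * c s)%g; split.
  - exact: (smooth_into_comp openT (smooth_mulgl a^-1%g) sc).
  - by move=> s; have := Kc s; rewrite /= invgM mulgA.
  - by rewrite c0 mulKg.
  - by rewrite velocity_mulgl ?c0 ?vc//; exact: (smooth_curve_continuous sc).
by have := dL_comp a^-1%g a (a * x)%g w; rewrite mulKg mulgV dL1 => ->.
Qed.

(** Left translation by [a] is undone when the velocity is moved back to the identity, and left
    invariance preserves the normalizing factor. The two zero cases match because [dL] is
    injective. *)
Lemma srv_mulgl a alpha t : {for t, continuous alpha} ->
  srv AG g (fun s => a * alpha s)%g t = srv AG g alpha t.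
Proof.
move=> ca; rewrite /srv velocity_mulgl// dL_eq0; case: ifPn => // _.
rewrite /tnorm hgL//; congr (_ *: _).
by rewrite dL_comp invgM -mulgA mulVg mulg1.
Qed.

Lemma projects_mulgl a p beta : projects AG K pi g p beta ->
  projects AG K pi g ((a * p.1)%g, p.2) (fun t => act a (beta t)).
Proof.
move=> [alpha [[ac perp] a0 Lp srvE piE]].
exists (fun s => a * alpha s)%g; split.
- split; first exact: (AC_curve_comp (smooth_mulgl a) ac).
  move: perp; apply: ae01_sub => t t01 perp w.
  move=> /tangent_to_mulgl[u tu ->].
  by rewrite velocity_mulgl ?hgL//; [exact: perp|exact: AC_curve_continuous ac _].
- by rewrite a0.
- exact: Lp.
- move: srvE; apply: ae01_sub => t t01 E.
  by rewrite srv_mulgl ?E//; exact: AC_curve_continuous ac _.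
- by move=> t t01; rewrite piE//; case: hM => _ [_ [_ [_ [_ ->]]]].
Qed.

Lemma transport_mulgl a : transport AG K AM pi g
  (fun beta t => act a (beta t)) (fun x => a * x)%g id.
Proof.
split=> //.
- exact: smooth_mulgl.
- by move=> x u v; exact: hgL.
- by move=> x y; rewrite mulgA.
- by move=> p beta; exact: projects_mulgl.
- by move=> beta; exact: (AC_curve_comp (smooth_act a)).
Qed.

Lemma actK a b : act a^-1%g (act a b) = b.
Proof.
case: hM => _ [_ [pi_surj [_ [_ actE]]]]; have [x <-] := pi_surj b.
by rewrite !actE mulKg.
Qed.

Lemma transport_pair_mulgl a : transport_pair AG K AM pi g
  (fun beta t => act a (beta t)) (fun x => a * x)%g id
  (fun beta t => act a^-1%g (beta t)) (fun x => a^-1 * x)%g id.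
Proof.
split=> //.
- exact: transport_mulgl.
- exact: transport_mulgl.
- exact: mulKg.
- exact: mulVKg.
- by move=> beta t _; rewrite actK.
- by move=> beta t _; have := actK a^-1%g (beta t); rewrite invgK.
Qed.

End LeftTranslation.

(** * Reparametrizations *)

Section ReparamTransport.
Context (R : realType) (n m : nat) (G : TopGroup.type) (AG : manifold R n G).
Context (K : set G) (M : topologicalType) (AM : manifold R m M).
Context (pi : G -> M) (g : G -> 'rV[R]_n -> 'rV[R]_n -> R).
Hypothesis hg : riemannian_metric AG g.

Lemma smooth_map_id : smooth_map AG AG id.
Proof.
move=> x; split; first by move=> v xv; exact: ichart_continuous.
by move=> y; exact: transition_smooth.
Qed.

(* The action of a reparametrization on the L^2 component, making q_(alpha o p)
   the image of q_alpha. *)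
Definition srv_reparam (p : R -> R) (f : R -> 'rV[R]_n) (t : R) : 'rV[R]_n :=
  Num.sqrt (jac p t) *: f (p t).

Section OneReparam.
Variables (p q : R -> R).
Hypothesis rpq : reparam p q.

Lemma measurable_srv_reparam f : measurable_coords f ->
  measurable_coords (srv_reparam p f).
Proof.
move=> mf j.
rewrite (_ : (fun t => _) = fun t => Num.sqrt (jac p t) * f (p t) 0 j); last first.
  by apply/funext => t; rewrite mxE.
apply: measurable_funM; last exact: (measurable_fun_reparam rpq (mf j)).
apply: (measurableT_comp (f := @Num.sqrt R)); last exact: (measurable_jac rpq).
by apply: continuous_measurable_fun => x; exact: sqrt_continuous.
Qed.

Lemma metric_srv_reparam x f h t : 0 <= t <= 1 ->
  g x (srv_reparam p f t) (srv_reparam p h t) = g x (f (p t)) (h (p t)) * jac p t.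
Proof.
move=> t01.
have E : Num.sqrt (jac p t) * Num.sqrt (jac p t) = jac p t.
  by rewrite -expr2 sqr_sqrtr// ltW// (jac_gt0 rpq).
rewrite /srv_reparam (metricZ hg).
by rewrite E mulrC.
Qed.

Lemma L2normsq_srv_reparam f : measurable_coords f ->
  L2normsq g (srv_reparam p f) = L2normsq g f.
Proof.
move=> mf; rewrite /L2normsq.
rewrite -(ge0_integral_reparam rpq (f := fun t => (g 1%g (f t) (f t))%:E)).
- apply: eq_integral => t; rewrite inE /= in_itv /= => t01.
  by rewrite metric_srv_reparam.
- by apply/measurable_EFinP; exact: (measurable_metric hg).
- by move=> t _; rewrite lee_fin (metric_ge0 hg).
Qed.

Lemma L2inner_srv_reparam f h : measurable_coords f -> measurable_coords h ->
  L2inner g (srv_reparam p f) (srv_reparam p h) = L2inner g f h.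
Proof.
move=> mf mh; rewrite /L2inner.
rewrite -(Rintegral_reparam rpq (f := fun t => g 1%g (f t) (h t))).
  apply: eq_Rintegral => t; rewrite inE /= in_itv /= => t01.
  by rewrite metric_srv_reparam.
exact: (measurable_metric hg).
Qed.

Lemma L2perp_srv_reparam f : L2perp AG K g f -> L2perp AG K g (srv_reparam p f).
Proof.
move=> [mf Lf pf]; split; first exact: measurable_srv_reparam.
  by have := L2normsq_srv_reparam mf; rewrite /L2normsq => ->.
have := ae_reparam rpq (P := fun t => forall xi, lie_algebra AG K xi -> g 1%g xi (f t) = 0) pf.
apply: ae01_sub => t t01 E xi Kxi.
by rewrite (metricC hg) (metricZl hg) (metricC hg) E// mulr0.
Qed.

Lemma velocity_reparam01 (alpha : R -> G) t : 0 < t < 1 ->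
  velocity AG (alpha \o p) t = derive1 p t *: velocity AG alpha (p t).
Proof.
move=> t01; have rqp := reparam_sym rpq; have pt01 := reparam_oo rpq t01.
have t01' : 0 <= t <= 1 by case/andP: t01 => ? ?; rewrite !ltW.
apply: velocity_reparam.
- exact: (reparam_derivable_oo rpq).
- exact: (reparam_derivable_oo rqp).
- exact: (reparamK rpq).
- exact: (reparam_near rqp).
Qed.

(** The velocity is multiplied by [c = derive1 p t] and the square root of its norm by the square
    root of [c]; the quotient leaves a factor equal to that square root. *)
Lemma srv_comp_reparam (alpha : R -> G) t : 0 < t < 1 ->
  srv AG g (alpha \o p) t = srv_reparam p (srv AG g alpha) t.
Proof.
move=> t01; have t01' : 0 <= t <= 1 by case/andP: t01 => ? ?; rewrite !ltW.
have := jac_gt0 rpq t01'; rewrite /srv_reparam /srv velocity_reparam01// /jac t01.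
set c := derive1 p t; set v := velocity AG alpha (p t) => c0.
rewrite scaler_eq0 gt_eqF//=; case: ifPn => [_|v0]; first by rewrite scaler0.
have -> : tnorm g (alpha (p t)) (c *: v) = c * tnorm g (alpha (p t)) v.
  rewrite /tnorm (metricZ hg) sqrtrM; last by rewrite mulr_ge0// ltW.
  by rewrite -expr2 sqrtr_sqr gtr0_norm.
rewrite sqrtrM; last exact: ltW.
rewrite /dL /dmap linearZ /= !scalerA; congr (_ *: _).
have sc0 : Num.sqrt c != 0 by rewrite gt_eqF// sqrtr_gt0.
rewrite invfM -[X in _ * X](sqr_sqrtr (ltW c0)) expr2.
by rewrite mulrAC mulrA mulVf// mul1r.
Qed.

Lemma projects_reparam pt beta : projects AG K pi g pt beta ->
  projects AG K pi g (pt.1, srv_reparam p pt.2) (beta \o p).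
Proof.
have [L L0 lip] := reparam_lipschitz rpq.
move=> [alpha [[ac perp] a0 Lp srvE piE]]; exists (alpha \o p); split.
- split; first exact: (AC_curve_reparam L0 (reparam01 rpq) lip ac).
  have := ae_reparam rpq (P := fun t => forall w,
    tangent_to AG [set z | K ((alpha t)^-1 * z)%g] (alpha t) w ->
     g (alpha t) (velocity AG alpha t) w = 0) perp.
  apply: ae01_sub => t t01 E w tw.
  by rewrite velocity_reparam01// (metricZl hg) E// mulr0.
- by rewrite /= (reparam0 rpq).
- exact: L2perp_srv_reparam.
- have := ae_reparam rpq (P := fun t => srv AG g alpha t = pt.2 t) srvE.
  by apply: ae01_sub => t t01 E; rewrite srv_comp_reparam// /srv_reparam E.
- by move=> t t01; rewrite /= piE// (reparam01 rpq).
Qed.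

(** The group component is the identity because [p 0 = 0] leaves the initial point of a lift
    unchanged. *)
Lemma transport_reparam : transport AG K AM pi g
  (fun beta => beta \o p) id (srv_reparam p).
Proof.
split.
- exact: smooth_map_id.
- by move=> x u v; rewrite !dmap_id.
- by [].
- move=> a f h; apply/funext => t.
  by rewrite /srv_reparam scalerDr !scalerA mulrC.
- by move=> L f; apply/funext => t; rewrite /srv_reparam linearZ.
- exact: L2perp_srv_reparam.
- exact: L2inner_srv_reparam.
- exact: L2normsq_srv_reparam.
- exact: projects_reparam.
- have [L L0 lip] := reparam_lipschitz rpq.
  by move=> beta; exact: (AC_curve_reparam L0 (reparam01 rpq) lip).
Qed.

(** The two square roots multiply to 1 by [jacVM], endpoints included thanks to the value of [jac]
    there. *)
Lemma srv_reparamK f : eq01 (srv_reparam q (srv_reparam p f)) f.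
Proof.
have rqp := reparam_sym rpq.
move=> t t01; rewrite /srv_reparam scalerA -sqrtrM; last first.
  by rewrite ltW// (jac_gt0 rqp).
by rewrite mulrC (jacVM rqp t01) sqrtr1 scale1r (reparamVK rpq).
Qed.

End OneReparam.

Lemma transport_pair_reparam p q : reparam p q -> transport_pair AG K AM pi g
  (fun beta => beta \o p) id (srv_reparam p) (fun beta => beta \o q) id (srv_reparam q).
Proof.
move=> rpq; have rqp := reparam_sym rpq; split=> //.
- exact: (transport_reparam rpq).
- exact: (transport_reparam rqp).
- exact: (srv_reparamK rpq).
- exact: (srv_reparamK rqp).
- by move=> beta t t01; rewrite /= (reparamVK rpq).
- by move=> beta t t01; rewrite /= (reparamK rpq).
Qed.

End ReparamTransport.

Theorem proposition4 (R : realType) (n m : nat)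
    (G : TopGroup.type) (AG : manifold R n G)
    (K : set G)
    (M : topologicalType) (AM : manifold R m M)
    (pi : G -> M) (act : G -> M -> M)
    (g : G -> 'rV[R]_n -> 'rV[R]_n -> R)
    (hG : lie_group AG)
    (hK : subgroup K) (hKc : compact K)
    (hM : homogeneous_space AG K AM pi act)
    (hg : riemannian_metric AG g)
    (hgL : left_invariant AG g setT)
    (hgKL : left_invariant AG g K)
    (hgKR : right_invariant AG g K) :
  (forall a : G,
     preserves_metric_and_dist AG K AM pi g (fun beta t => act a (beta t))) /\
  (forall gamma : R -> R, diff_plus gamma ->
     preserves_metric_and_dist AG K AM pi g (fun beta => beta \o gamma)).
Proof.
split=> [a|gamma /diff_plus_reparam[delta rgd]].
  exact: (transport_preserves hG (transport_pair_mulgl hG hM hgL a)).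
exact: (transport_preserves hG (transport_pair_reparam K AM pi hg rgd)).
Qed.
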